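(* The following equalities up to an additive constant hold between functions $\mathbb{N}\to\mathbb{N}$ (where $\upharpoonright\mathbb{N}$ denotes restriction to $\mathbb{N}$): \begin{enumerate} \item $K^{\mathbb{N}}_{Church} =_{\rm ct} K^{\mathbb{Z}}_{Church}\upharpoonright\mathbb{N} =_{\rm ct} K^{\mathbb{Z}}_{\Delta Church}\upharpoonright\mathbb{N} =_{\rm ct} K$; \item $K^{\mathbb{N}}_{card} =_{\rm ct} K_{\max}$ and $K^{\mathbb{Z}}_{\Delta card}\upharpoonright\mathbb{N} =_{\rm ct} K^{\emptyset'}$; \item $K^{\mathbb{N}}_{index} =_{\rm ct} K_{\max}^{\emptyset'}$ and $K^{\mathbb{Z}}_{\Delta index}\upharpoonright\mathbb{N} =_{\rm ct} K^{\emptyset''}$. \end{enumerate}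
   Context: For $f,g:D\to\mathbb{N}$: $f\leq_{\rm ct} g$ means $\exists c\,\forall x\in D\ f(x)\leq g(x)+c$; $f=_{\rm ct}g$ means $f\leq_{\rm ct}g$ and $g\leq_{\rm ct}f$. $\mathbf{2}^*$ is the set of finite binary words, $|p|$ the length of $p$. Equality between values of partial functions means both undefined, or both defined and equal. $\emptyset',\emptyset''$ are the first and second Turing jumps of $\emptyset$. Self-enumerated systems. A self-enumerated representation system is a pair $(D,\mathcal F)$, $D$ a set and $\mathcal F$ a family of partial functions $\mathbf 2^*\to D$, with: (i) $D=\bigcup_{F\in\mathcal F}Range(F)$; (ii) $F\circ\varphi\in\mathcal F$ for all $F\in\mathcal F$ and total recursive $\varphi:\mathbf 2^*\to\mathbf 2^*$; (iii) there are $U\in\mathcal F$ (called universal) and a total recursive $comp_U:\mathbf 2^*\times\mathbf 2^*\to\mathbf 2^*$ with $\forall F\in\mathcal F\ \exists e\ \forall p\ F(p)=U(comp_U(e,p))$. $U$ is good if moreover for every $e$ there is $c_e$ with $|comp_U(e,p)|\le|p|+c_e$ for all $p$. Every such system has a good universal function, and its Kolmogorov complexity is $K^D_{\mathcal F}(x)=\min\{|p|:U(p)=x\}$ for a fixed good universal $U$ (well-defined up to an additive constant). All families below form such systems. Oracular and infinite-computation complexities. For $A\subseteq\mathbb N$, $K^A:\mathbb N\to\mathbb N$ is the Kolmogorov complexity of the family of all partial $A$-recursive functions $\mathbf 2^*\to\mathbb N$; $K=K^\emptyset$. For partial $f:\mathbf 2^*\times\mathbb N\to\mathbb N$, $(\max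 f)(p)=\max\{f(p,t):t\in\mathbb N\}$, undefined if this set is empty or infinite. $K_{\max}^A$ is the Kolmogorov complexity of the family $\{\max f: f:\mathbf 2^*\times\mathbb N\to\mathbb N \text{ partial } A\text{-recursive}\}$; $K_{\max}=K_{\max}^\emptyset$. $\Delta$ operation. For a family $\mathcal F$ of partial functions $\mathbf 2^*\to\mathbb N$, $\Delta\mathcal F$ is the family of partial functions $p\mapsto F_1(p)-F_2(p)$ from $\mathbf 2^*$ to $\mathbb Z$, $F_1,F_2\in\mathcal F$ (defined iff both terms are). Cardinal and index. Let $(W^{\mathbb N}_e)_{e\in\mathbf 2^*}$, $(W^{\mathbb N^2}_e)_{e\in\mathbf 2^*}$ be acceptable enumerations (domains of the functions in a standard, i.e. partial recursive with s-m-n property, enumeration of partial recursive functions) of the r.e. subsets of $\mathbb N$ and of $\mathbb N^2$. $card(Y)$ is the number of elements of $Y\subseteq\mathbb N$ if $Y$ is finite, undefined otherwise. $index(\rho)$ is the number of equivalence classes if $\rho\subseteq\mathbb N^2$ is an equivalence relation on some subset of $\mathbb N$ with finitely many classes, undefined otherwise. $K^{\mathbb N}_{card}$ (resp. $K^{\mathbb N}_{index}$) is the Kolmogorov complexity of the family of all $p\mapsto card(W^{\mathbb N}_{\varphi(p)})$ (resp. $p\mapsto index(W^{\mathbb N^2}_{\varphi(p)})$), $\varphi:\mathbf 2^*\to\mathbf 2^*$ total recursive. $K^{\mathbb Z}_{\Delta card}$, $K^{\mathbb Z}_{\Delta index}:\mathbb Z\to\mathbb N$ are the Kolmogorov complexities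 of the images of these families under $\Delta$. Church. $\mathbb N\to\mathbb N$ denotes the set of partial functions, $Fin(\mathbb N\to\mathbb N)$ those with finite domain. An r.e. relation $R\subseteq Fin(\mathbb N\to\mathbb N)\times\mathbf 2^*\times\mathbb N\times\mathbb N$ is functional if $y=y'$ whenever $(\alpha,p,x,y),(\beta,p,x,y')\in R$ and $\alpha\cup\beta$ is a function. The associated effectively continuous functional $\Phi_R:\mathbf 2^*\to((\mathbb N\to\mathbb N)\to(\mathbb N\to\mathbb N))$ is given by: $\Phi_R(p)(f)(x)=y$ iff $(u,p,x,y)\in R$ for some finite $u\subseteq f$. Iterates: $f^{(0)}=Id$, $f^{(n+1)}=f^{(n)}\circ f$. $Church^{\mathbb N}(\Psi)=n$ if $\Psi(f)=f^{(n)}$ for all partial $f:\mathbb N\to\mathbb N$, undefined if there is no such $n$. $K^{\mathbb N}_{Church}$ is the Kolmogorov complexity of the family of all $p\mapsto Church^{\mathbb N}(\Phi(p))$, $\Phi$ effectively continuous, and $K^{\mathbb Z}_{\Delta Church}$ that of the image of this family under $\Delta$. $K^{\mathbb Z}_{Church}$ is obtained similarly with injective partial functions: finite functions $\alpha,\beta$ and arguments $f$ range over injective partial functions $\mathbb N\to\mathbb N$ only, functionality of $R$ is required only when $\alpha\cup\beta$ is an injective function, and $Church^{\mathbb Z}(\Psi)=z\in\mathbb Z$ if for all injective partial $f$, $\Psi(f)=f^{(z)}$ when $z\ge0$, $\Psi(f)=(f^{-1})^{(-z)}$ when $z<0$ (undefined if there is no such $z$). *)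

(* Defs.v *)
From Stdlib Require Import Arith ZArith List Sorted Cantor ClassicalEpsilon.
Import ListNotations.
Set Implicit Arguments.

(** Partial functions [X -> Y] are total functions [X -> option Y], so that
    [=] between values is "both undefined, or both defined and equal". *)

Definition word := list bool.

(** * Recursive functions relative to an oracle *)

(** Codes of the partial recursive functions [nat -> nat]; tuples of arguments
    are passed through Cantor's pairing. *)
Inductive code : Type :=
| cZero | cSucc | cFst | cSnd | cOracle
| cPair (a b : code)
| cComp (a b : code)
| cPrec (a b : code)
| cMu (a : code).

Notation pair_num x y := (Cantor.to_nat (x, y)).

(** [eval A c x y]: with oracle (the characteristic function of) [A], the
    program [c] halts on input [x] with output [y].
    [cPrec a b] maps <x,0> to a(x) and <x,n+1> to b<x,<n,r>>, where r is the
    value at <x,n>; [cMu a] maps x to the least n such that a<x,n> = 0,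
    a<x,m> being defined for all m < n. *)
Fixpoint eval (A : nat -> Prop) (c : code) : nat -> nat -> Prop :=
  match c with
  | cZero => fun _ y => y = 0
  | cSucc => fun x y => y = S x
  | cFst => fun x y => y = fst (Cantor.of_nat x)
  | cSnd => fun x y => y = snd (Cantor.of_nat x)
  | cOracle => fun x y => (A x /\ y = 1) \/ (~ A x /\ y = 0)
  | cPair a b => fun x y =>
      exists u v, eval A a x u /\ eval A b x v /\ y = pair_num u v
  | cComp a b => fun x y => exists u, eval A b x u /\ eval A a u y
  | cPrec a b => fun xn =>
      let x := fst (Cantor.of_nat xn) in
      nat_rect (fun _ => nat -> Prop)
        (eval A a x)
        (fun n ih y => exists r, ih r /\ eval A b (pair_num x (pair_num n r)) y)
        (snd (Cantor.of_nat xn))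
  | cMu a => fun x n =>
      eval A a (pair_num x n) 0 /\
      forall m, m < n -> exists k, eval A a (pair_num x m) (S k)
  end.

Fixpoint code_num (c : code) : nat :=
  match c with
  | cZero => pair_num 0 0
  | cSucc => pair_num 1 0
  | cFst => pair_num 2 0
  | cSnd => pair_num 3 0
  | cOracle => pair_num 4 0
  | cPair a b => pair_num 5 (pair_num (code_num a) (code_num b))
  | cComp a b => pair_num 6 (pair_num (code_num a) (code_num b))
  | cPrec a b => pair_num 7 (pair_num (code_num a) (code_num b))
  | cMu a => pair_num 8 (code_num a)
  end.

Definition emptyset : nat -> Prop := fun _ => False.

Definition jump (A : nat -> Prop) : nat -> Prop :=
  fun n => exists c, code_num c = n /\ exists y, eval A c n y.

(** Injective numberings of the data types on which functions are computed. *)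
Class Numbering (X : Type) : Type := num : X -> nat.

#[global] Instance num_nat : Numbering nat := fun n => n.

(** Bijective base 2, i.e. a bijection between words and natural numbers. *)
#[global] Instance num_word : Numbering word :=
  fix go (w : word) : nat :=
    match w with
    | [] => 0
    | false :: w' => 2 * go w' + 1
    | true :: w' => 2 * go w' + 2
    end.

#[global] Instance num_prod (X Y : Type) (nX : Numbering X) (nY : Numbering Y) :
  Numbering (X * Y) := fun xy => pair_num (num (fst xy)) (num (snd xy)).

Definition partial_recursive (A : nat -> Prop) (X Y : Type)
    (nX : Numbering X) (nY : Numbering Y) (f : X -> option Y) : Prop :=
  exists c, forall x n,
    eval A c (num x) n <-> exists y, f x = Some y /\ n = num y.
Arguments partial_recursive A {X Y nX nY} f.

Definition total_recursive (X Y : Type)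
    (nX : Numbering X) (nY : Numbering Y) (f : X -> Y) : Prop :=
  partial_recursive emptyset (fun x => Some (f x)).
Arguments total_recursive {X Y nX nY} f.

Definition recursively_enumerable (X : Type) (nX : Numbering X)
    (S : X -> Prop) : Prop :=
  exists c, forall x, S x <-> exists n, eval emptyset c (num x) n.
Arguments recursively_enumerable {X nX} S.

(** * Self-enumerated systems and their Kolmogorov complexity *)

Definition family (D : Type) := (word -> option D) -> Prop.

Definition good_universal (D : Type) (F : family D) (U : word -> option D) : Prop :=
  F U /\
  exists comp : word -> word -> word,
    total_recursive (fun ep : word * word => comp (fst ep) (snd ep)) /\
    (forall G, F G -> exists e, forall p, G p = U (comp e p)) /\
    (forall e, exists c, forall p, length (comp e p) <= length p + c).

Definition is_complexity (D : Type) (F : family D) (k : D -> nat) : Prop :=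
  exists U, good_universal F U /\
    forall x,
      (exists p, U p = Some x /\ length p = k x) /\
      (forall p, U p = Some x -> k x <= length p).

(** The good universal function is fixed by Hilbert's epsilon; another choice
    changes the complexity by at most an additive constant. *)
Definition complexity (D : Type) (F : family D) : D -> nat :=
  epsilon (inhabits (fun _ => 0)) (is_complexity F).

Definition ct_le (D : Type) (f g : D -> nat) : Prop :=
  exists c, forall x, f x <= g x + c.

Definition ct_eq (D : Type) (f g : D -> nat) : Prop := ct_le f g /\ ct_le g f.

Definition restrict_nat (k : Z -> nat) : nat -> nat := fun n => k (Z.of_nat n).

(** [p |-> v], where [v] is the unique value with [P p v] if there is one. *)
Definition defined_by (D : Type) (G : word -> option D) (P : word -> D -> Prop) :
  Prop := forall p v, G p = Some v <-> P p v.

Definition Delta (F : family nat) : family Z := fun G =>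
  exists F1 F2, F F1 /\ F F2 /\
    forall p, G p = match F1 p, F2 p with
                    | Some a, Some b => Some (Z.of_nat a - Z.of_nat b)%Z
                    | _, _ => None
                    end.

(** * Oracular and infinite computations *)

Definition PR (A : nat -> Prop) : family nat := fun G => partial_recursive A G.

(** A set of natural numbers has a greatest element iff it is finite and
    nonempty. *)
Definition is_max (f : word * nat -> option nat) (p : word) (m : nat) : Prop :=
  (exists t, f (p, t) = Some m) /\ forall t v, f (p, t) = Some v -> v <= m.

Definition MaxPR (A : nat -> Prop) : family nat := fun G =>
  exists f : word * nat -> option nat,
    partial_recursive A f /\ defined_by G (is_max f).

(** * Cardinal and index *)

(** Partial recursive in (e,x), enumerating all the partial recursive
    functions, and with the s-m-n (parametrization) property. *)
Definition standard_enumeration (X : Type) (nX : Numbering X)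
    (phi : word -> X -> option nat) : Prop :=
  partial_recursive emptyset (fun ex : word * X => phi (fst ex) (snd ex)) /\
  (forall f : X -> option nat, partial_recursive emptyset f ->
     exists e, forall x, phi e x = f x) /\
  (forall psi : word * X -> option nat, partial_recursive emptyset psi ->
     exists s : word -> word, total_recursive s /\
       forall p x, phi (s p) x = psi (p, x)).

Definition acceptable (X : Type) (nX : Numbering X) (W : word -> X -> Prop) : Prop :=
  exists phi, standard_enumeration nX phi /\
    forall e x, W e x <-> exists y, phi e x = Some y.
Arguments acceptable {X nX} W.

Definition has_card (T : Type) (Y : T -> Prop) (n : nat) : Prop :=
  exists l : list T, NoDup l /\ (forall x, In x l <-> Y x) /\ length l = n.

Definition equivalence_on (S : nat -> Prop) (rho : nat * nat -> Prop) : Prop :=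
  (forall x y, rho (x, y) -> S x /\ S y) /\
  (forall x, S x -> rho (x, x)) /\
  (forall x y, rho (x, y) -> rho (y, x)) /\
  (forall x y z, rho (x, y) -> rho (y, z) -> rho (x, z)).

Definition has_index (rho : nat * nat -> Prop) (n : nat) : Prop :=
  exists S, equivalence_on S rho /\
    has_card (fun C : nat -> Prop => exists x, S x /\ C = fun y => rho (x, y)) n.

Definition Card (W : word -> nat -> Prop) : family nat := fun G =>
  exists phi : word -> word, total_recursive phi /\
    defined_by G (fun p => has_card (W (phi p))).

Definition Index (W : word -> nat * nat -> Prop) : family nat := fun G =>
  exists phi : word -> word, total_recursive phi /\
    defined_by G (fun p => has_index (W (phi p))).

(** * Church numerals *)

Definition pfun := nat -> option nat.

Definition graph (f : pfun) : nat -> nat -> Prop := fun x y => f x = Some y.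

(** A function with finite domain is represented by its graph, listed in
    increasing order of the arguments. *)
Record finfun : Type := Finfun {
  fin_list : list (nat * nat);
  fin_sorted : StronglySorted (fun a b => fst a < fst b) fin_list
}.

Definition fin_graph (u : finfun) : nat -> nat -> Prop :=
  fun x y => In (x, y) (fin_list u).

#[global] Instance num_finfun : Numbering finfun := fun u =>
  (fix go (l : list (nat * nat)) : nat :=
     match l with
     | [] => 0
     | a :: l' => S (pair_num (num a) (go l'))
     end) (fin_list u).

Definition is_function (r : nat -> nat -> Prop) : Prop :=
  forall x y y', r x y -> r x y' -> y = y'.

Definition is_injective_function (r : nat -> nat -> Prop) : Prop :=
  is_function r /\ forall x x' y, r x y -> r x' y -> x = x'.

(** Below, [C] is [is_function] or [is_injective_function]: it selects the
    partial functions over which the finite functions and the arguments of the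
    functionals range. *)

Definition functional (C : (nat -> nat -> Prop) -> Prop)
    (R : finfun * word * nat * nat -> Prop) : Prop :=
  (forall u p x y, R (u, p, x, y) -> C (fin_graph u)) /\
  (forall u v p x y y',
     R (u, p, x, y) -> R (v, p, x, y') ->
     C (fun a b => fin_graph u a b \/ fin_graph v a b) -> y = y').

(** The values of [Phi p] at arguments outside the class [C] are irrelevant. *)
Definition effectively_continuous (C : (nat -> nat -> Prop) -> Prop)
    (Phi : word -> pfun -> pfun) : Prop :=
  exists R : finfun * word * nat * nat -> Prop,
    recursively_enumerable R /\ functional C R /\
    forall p f, C (graph f) -> forall x y,
      Phi p f x = Some y <->
      exists u, (forall a b, fin_graph u a b -> graph f a b) /\ R (u, p, x, y).

Fixpoint iterate (f : pfun) (n : nat) (x : nat) : option nat :=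
  match n with
  | 0 => Some x
  | S m => match f x with Some y => iterate f m y | None => None end
  end.

Definition inverse_of (f g : pfun) : Prop :=
  forall x y, g y = Some x <-> f x = Some y.

Definition church_nat (Psi : pfun -> pfun) (n : nat) : Prop :=
  forall f x, Psi f x = iterate f n x.

Definition church_int (Psi : pfun -> pfun) (z : Z) : Prop :=
  forall f, is_injective_function (graph f) ->
    ((0 <= z)%Z -> forall x, Psi f x = iterate f (Z.to_nat z) x) /\
    ((z < 0)%Z -> exists g, inverse_of f g /\
       forall x, Psi f x = iterate g (Z.to_nat (- z)) x).

Definition ChurchN : family nat := fun G =>
  exists Phi, effectively_continuous is_function Phi /\
    defined_by G (fun p => church_nat (Phi p)).

Definition ChurchZ : family Z := fun G =>
  exists Phi, effectively_continuous is_injective_function Phi /\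
    defined_by G (fun p => church_int (Phi p)).

(** * The complexities *)

Definition K_oracle (A : nat -> Prop) : nat -> nat := complexity (PR A).
Definition K : nat -> nat := K_oracle emptyset.
Definition Kmax_oracle (A : nat -> Prop) : nat -> nat := complexity (MaxPR A).
Definition Kmax : nat -> nat := Kmax_oracle emptyset.

Definition KN_church : nat -> nat := complexity ChurchN.
Definition KZ_church : Z -> nat := complexity ChurchZ.
Definition KZ_Delta_church : Z -> nat := complexity (Delta ChurchN).

Definition KN_card W : nat -> nat := complexity (Card W).
Definition KZ_Delta_card W : Z -> nat := complexity (Delta (Card W)).
Definition KN_index W : nat -> nat := complexity (Index W).
Definition KZ_Delta_index W : Z -> nat := complexity (Delta (Index W)).

Notation "f =ct g" := (ct_eq f g) (at level 70, no associativity).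

(* Main.v *)
(** A bound [K_F <= K_F' + O(1)] holds as soon as every function of the family
    [F'] extends to a function of [F]. The words [1^n 0 p], with [n] the number of
    a program, give a good universal function for each of the families.

    The Church numeral of [n] sends the successor function and [0] to [n], so
    partial recursive functions extend all those defined by Church numerals;
    conversely [f |-> f^(n)] is effectively continuous, uniformly in [n].

    The cardinal of an r.e. set is the maximum of the sizes of its finite subsets,
    and the index of an r.e. equivalence relation is the maximum of the sizes of
    its finite sets of inequivalent elements, which are r.e. in the jump. In the
    other direction [max f] is the number of [n] with [n < f(p,t)] for some [t];
    for the index, the set of these [n] is [Sigma_2], and there is an r.e.
    equivalence relation with one class for each element of this set and one more.
    By Post's theorem, a function partial recursive in the jump of [B] is obtained
    from the least [v] that is never refuted by a [B]-r.e. relation, and this [v]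
    can be read off the difference of two maxima. *)

Require Import Defs.
From Stdlib Require Import Arith ZArith List Sorted Cantor Lia Wf_nat.
From Stdlib Require Import ClassicalEpsilon FunctionalExtensionality PropExtensionality.
Import ListNotations.
Set Implicit Arguments.

Local Notation "<< x , y >>" := (Cantor.to_nat (x, y)).

(** Passing to extensions is what keeps the comparisons effective: that a set is infinite, that a
    relation is no equivalence or that a functional is no numeral need not be preserved, since a
    shortest program of a value only has to keep that value. The statements on cardinals and on
    indices are two instances of one argument, [counting B F d]: oracle [emptyset] and shift 0 for
    cardinals, oracle [jump emptyset] and shift 1 for indices. The level rises because distinctness
    of classes is the complement of an r.e. relation. In return an index has to count a Sigma_2 set,
    and an element with several unrefuted witnesses would be counted several times; hence the effort
    to make witnesses unique. The shift comes from the class that absorbs the refuted witnesses, and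
    the finitely many values below it only affect the additive constant. For Church numerals the
    obstacle is the universal function: functionality of an r.e. relation is not tested, every
    relation is trimmed to a functional one in a way that leaves functional relations intact. *)

Definition pi1 (z : nat) : nat := fst (Cantor.of_nat z).
Definition pi2 (z : nat) : nat := snd (Cantor.of_nat z).

Lemma pi1_pair x y : pi1 <<x, y>> = x.
Proof. unfold pi1; now rewrite Cantor.cancel_of_to. Qed.

Lemma pi2_pair x y : pi2 <<x, y>> = y.
Proof. unfold pi2; now rewrite Cantor.cancel_of_to. Qed.

Lemma pair_pi z : <<pi1 z, pi2 z>> = z.
Proof.
  unfold pi1, pi2; rewrite <- surjective_pairing; apply Cantor.cancel_to_of.
Qed.

Lemma pair_inj x y x' y' : <<x, y>> = <<x', y'>> -> x = x' /\ y = y'.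
Proof. intros H; apply Cantor.to_nat_inj in H; now inversion H. Qed.

Lemma pair_le x y : x <= <<x, y>> /\ y <= <<x, y>>.
Proof. pose proof (Cantor.to_nat_non_decreasing x y); lia. Qed.

Lemma pi2_le z : pi2 z <= z.
Proof. rewrite <- (pair_pi z) at 2; apply pair_le. Qed.

Global Opaque Cantor.to_nat Cantor.of_nat.

#[global] Hint Rewrite pi1_pair pi2_pair pair_pi : pi.

Lemma eval_fst A x y : eval A cFst x y <-> y = pi1 x.
Proof. reflexivity. Qed.

(** * Total recursive functions, decidable and semidecidable predicates *)

Definition Rec (A : nat -> Prop) (f : nat -> nat) : Prop :=
  exists c, forall x y, eval A c x y <-> y = f x.

Lemma rec_ext A f g : (forall x, f x = g x) -> Rec A f -> Rec A g.
Proof. intros E [c Hc]; exists c; intros x y; now rewrite Hc, E. Qed.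

Lemma rec_id A : Rec A (fun x => x).
Proof.
  exists (cPair cFst cSnd); intros x y; cbn [eval]; fold (pi1 x) (pi2 x).
  split; [intros (u & v & -> & -> & ->) | intros ->; exists (pi1 x), (pi2 x)];
    now rewrite pair_pi.
Qed.

Lemma rec_app A f g : Rec A f -> Rec A g -> Rec A (fun x => f (g x)).
Proof.
  intros [c Hc] [d Hd]; exists (cComp c d); intros x y; cbn; split.
  - intros (u & Hu & Hy); apply Hd in Hu as ->; now apply Hc.
  - intros ->; exists (g x); now rewrite Hd, Hc.
Qed.

Lemma rec_S A f : Rec A f -> Rec A (fun x => S (f x)).
Proof. apply (@rec_app A S); now exists cSucc. Qed.

Lemma rec_pi1 A f : Rec A f -> Rec A (fun x => pi1 (f x)).
Proof. apply (@rec_app A pi1); now exists cFst. Qed.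

Lemma rec_pi2 A f : Rec A f -> Rec A (fun x => pi2 (f x)).
Proof. apply (@rec_app A pi2); now exists cSnd. Qed.

Lemma rec_pair A f g : Rec A f -> Rec A g -> Rec A (fun x => <<f x, g x>>).
Proof.
  intros [c Hc] [d Hd]; exists (cPair c d); intros x y; cbn; split.
  - intros (u & v & Hu & Hv & ->); apply Hc in Hu as ->; now apply Hd in Hv as ->.
  - intros ->; exists (f x), (g x); now rewrite Hc, Hd.
Qed.

Lemma rec_const A n : Rec A (fun _ => n).
Proof.
  induction n as [|n IH]; [now exists cZero | now apply rec_S in IH].
Qed.

Lemma rec_nat_rect A a b k :
  Rec A a -> Rec A (fun z => b (pi1 z) (pi1 (pi2 z)) (pi2 (pi2 z))) -> Rec A k ->
  Rec A (fun x => nat_rect (fun _ => nat) (a x) (b x) (k x)).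
Proof.
  intros [ca Ha] [cb Hb] Hk.
  assert (H : Rec A (fun z => nat_rect (fun _ => nat) (a (pi1 z)) (b (pi1 z)) (pi2 z))).
  { exists (cPrec ca cb); intros z; cbn; fold (pi1 z) (pi2 z).
    induction (pi2 z) as [|n IH]; intros y; cbn; [apply Ha|].
    split.
    - intros (r & Hr & Hy); apply IH in Hr as ->; apply Hb in Hy.
      now autorewrite with pi in Hy.
    - intros ->; eexists; split; [now apply IH|].
      apply Hb; now autorewrite with pi. }
  apply (rec_ext (f := fun x => nat_rect (fun _ => nat)
    (a (pi1 <<x, k x>>)) (b (pi1 <<x, k x>>)) (pi2 <<x, k x>>))).
  - intros x; now autorewrite with pi.
  - exact (rec_app H (rec_pair (rec_id A) Hk)).
Qed.

Lemma eval_prec_0 A a b x y : eval A (cPrec a b) <<x, 0>> y <-> eval A a x y.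
Proof.
  cbn; fold (pi1 <<x, 0>>) (pi2 <<x, 0>>); now autorewrite with pi.
Qed.

Lemma eval_prec_S A a b x n y :
  eval A (cPrec a b) <<x, S n>> y <->
  exists r, eval A (cPrec a b) <<x, n>> r /\ eval A b <<x, <<n, r>>>> y.
Proof.
  cbn; fold (pi1 <<x, S n>>) (pi2 <<x, S n>>) (pi1 <<x, n>>) (pi2 <<x, n>>).
  now autorewrite with pi.
Qed.

Global Opaque pi1 pi2.

Lemma rec_pred A f : Rec A f -> Rec A (fun x => pred (f x)).
Proof.
  intros Hf.
  apply (rec_ext (f := fun x => nat_rect (fun _ => nat) 0 (fun n _ => n) (f x))).
  - intros x; now destruct (f x).
  - apply (rec_nat_rect (a := fun _ => 0) (fun _ n _ => n));
      [apply rec_const | apply rec_pi1, rec_pi2, rec_id | exact Hf].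
Qed.

Lemma rec_add A f g : Rec A f -> Rec A g -> Rec A (fun x => f x + g x).
Proof.
  intros Hf Hg.
  apply (rec_ext (f := fun x => nat_rect (fun _ => nat) (f x) (fun _ r => S r) (g x))).
  - intros x; induction (g x) as [|n IH]; cbn; lia.
  - apply (rec_nat_rect (a := f) (fun _ _ r => S r));
      [exact Hf | apply rec_S, rec_pi2, rec_pi2, rec_id | exact Hg].
Qed.

Lemma rec_sub A f g : Rec A f -> Rec A g -> Rec A (fun x => f x - g x).
Proof.
  intros Hf Hg.
  apply (rec_ext (f := fun x => nat_rect (fun _ => nat) (f x) (fun _ r => pred r) (g x))).
  - intros x; induction (g x) as [|n IH]; cbn; lia.
  - apply (rec_nat_rect (a := f) (fun _ _ r => pred r));
      [exact Hf | apply rec_pred, rec_pi2, rec_pi2, rec_id | exact Hg].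
Qed.

(** Zero stands for truth, as in [cMu]: conjunction becomes a sum and bounded universal
    quantification an iterated sum. *)
Definition Dec (A : nat -> Prop) (P : nat -> Prop) : Prop :=
  exists f, Rec A f /\ forall x, P x <-> f x = 0.

Lemma dec_ext A (P Q : nat -> Prop) : (forall x, P x <-> Q x) -> Dec A P -> Dec A Q.
Proof.
  intros E [f [Hf HP]]; exists f; split; [exact Hf|]; intros x; now rewrite <- E.
Qed.

Lemma dec_em A P x : Dec A P -> P x \/ ~ P x.
Proof.
  intros [f [_ H]]; rewrite H; destruct (f x); [now left | now right].
Qed.

Lemma dec_app A (P : nat -> Prop) f : Dec A P -> Rec A f -> Dec A (fun x => P (f x)).
Proof.
  intros [g [Hg HP]] Hf; exists (fun x => g (f x)); split; [now apply rec_app|].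
  intros x; apply HP.
Qed.

Lemma dec_eq A f g : Rec A f -> Rec A g -> Dec A (fun x => f x = g x).
Proof.
  intros Hf Hg; exists (fun x => (f x - g x) + (g x - f x)); split.
  - apply rec_add; now apply rec_sub.
  - intros x; lia.
Qed.

Lemma dec_lt A f g : Rec A f -> Rec A g -> Dec A (fun x => f x < g x).
Proof.
  intros Hf Hg; exists (fun x => S (f x) - g x); split.
  - apply rec_sub; [now apply rec_S | exact Hg].
  - intros x; lia.
Qed.

Lemma dec_le A f g : Rec A f -> Rec A g -> Dec A (fun x => f x <= g x).
Proof.
  intros Hf Hg; exists (fun x => f x - g x); split.
  - now apply rec_sub.
  - intros x; lia.
Qed.

Lemma dec_not A P : Dec A P -> Dec A (fun x => ~ P x).
Proof.
  intros [f [Hf HP]]; exists (fun x => 1 - f x); split.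
  - apply rec_sub; [apply rec_const | exact Hf].
  - intros x; rewrite HP; lia.
Qed.

Lemma dec_and A P Q : Dec A P -> Dec A Q -> Dec A (fun x => P x /\ Q x).
Proof.
  intros [f [Hf HP]] [g [Hg HQ]]; exists (fun x => f x + g x); split.
  - now apply rec_add.
  - intros x; rewrite HP, HQ; lia.
Qed.

Lemma dec_or A P Q : Dec A P -> Dec A Q -> Dec A (fun x => P x \/ Q x).
Proof.
  intros HP HQ.
  apply (dec_ext (P := fun x => ~ (~ P x /\ ~ Q x))).
  - intros x; tauto.
  - apply dec_not, dec_and; now apply dec_not.
Qed.

Lemma dec_imp A P Q : Dec A P -> Dec A Q -> Dec A (fun x => P x -> Q x).
Proof.
  intros HP HQ; apply (dec_ext (P := fun x => ~ P x \/ Q x)).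
  - intros x; tauto.
  - apply dec_or; [now apply dec_not | exact HQ].
Qed.

Lemma dec_all A (P : nat -> nat -> Prop) k :
  Dec A (fun z => P (pi1 z) (pi2 z)) -> Rec A k ->
  Dec A (fun x => forall i, i < k x -> P x i).
Proof.
  intros [f [Hf HP]] Hk.
  exists (fun x => nat_rect (fun _ => nat) 0 (fun i r => r + f <<x, i>>) (k x)); split.
  - apply (rec_nat_rect (a := fun _ => 0) (fun x i r => r + f <<x, i>>)).
    + apply rec_const.
    + apply rec_add; [apply rec_pi2, rec_pi2, rec_id|].
      apply (rec_app Hf), rec_pair; [apply rec_pi1, rec_id|].
      apply rec_pi1, rec_pi2, rec_id.
    + exact Hk.
  - intros x; induction (k x) as [|n IH]; cbn; [split; [trivial | lia]|].
    specialize (HP <<x, n>>); autorewrite with pi in HP.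
    split.
    + intros H; assert (nat_rect (fun _ => nat) 0 (fun i r => r + f <<x, i>>) n = 0).
      { apply IH; intros i Hi; apply H; lia. }
      assert (f <<x, n>> = 0) by (apply HP, H; lia); lia.
    + intros H i Hi; destruct (Nat.eq_dec i n) as [->|]; [apply HP; lia|].
      apply IH; lia.
Qed.

Lemma dec_ex A (P : nat -> nat -> Prop) k :
  Dec A (fun z => P (pi1 z) (pi2 z)) -> Rec A k ->
  Dec A (fun x => exists i, i < k x /\ P x i).
Proof.
  intros HP Hk; apply (dec_ext (P := fun x => ~ forall i, i < k x -> ~ P x i)).
  - intros x; split.
    + intros H; apply NNPP; firstorder.
    + firstorder.
  - apply dec_not, dec_all; [now apply dec_not | exact Hk].
Qed.

Definition Sig (A : nat -> Prop) (P : nat -> Prop) : Prop :=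
  exists D, Dec A D /\ forall x, P x <-> exists k, D <<x, k>>.

Lemma sig_ext A (P Q : nat -> Prop) : (forall x, P x <-> Q x) -> Sig A P -> Sig A Q.
Proof.
  intros E [D [HD HP]]; exists D; split; [exact HD|]; intros x; now rewrite <- E.
Qed.

Lemma sig_dec A P : Dec A P -> Sig A P.
Proof.
  intros HP; exists (fun z => P (pi1 z)); split.
  - apply (dec_app HP), rec_pi1, rec_id.
  - intros x; split; [intros H; exists 0 | intros [k H]]; now autorewrite with pi in *.
Qed.

Lemma sig_app A (P : nat -> Prop) f : Sig A P -> Rec A f -> Sig A (fun x => P (f x)).
Proof.
  intros [D [HD HP]] Hf; exists (fun z => D <<f (pi1 z), pi2 z>>); split.
  - apply (dec_app HD), rec_pair; [apply (rec_app Hf)|]; [apply rec_pi1|apply rec_pi2]; apply rec_id.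
  - intros x; rewrite HP; split; intros [k H]; exists k; now autorewrite with pi in *.
Qed.

Lemma sig_and A P Q : Sig A P -> Sig A Q -> Sig A (fun x => P x /\ Q x).
Proof.
  intros [D [HD HP]] [E [HE HQ]].
  exists (fun z => D <<pi1 z, pi1 (pi2 z)>> /\ E <<pi1 z, pi2 (pi2 z)>>); split.
  - apply dec_and; [apply (dec_app HD) | apply (dec_app HE)]; apply rec_pair;
      repeat first [apply rec_id | apply rec_pi1 | apply rec_pi2].
  - intros x; rewrite HP, HQ; split.
    + intros [[k Hk] [l Hl]]; exists <<k, l>>; now autorewrite with pi.
    + intros [k [H1 H2]]; autorewrite with pi in *; eauto.
Qed.

Lemma sig_or A P Q : Sig A P -> Sig A Q -> Sig A (fun x => P x \/ Q x).
Proof.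
  intros [D [HD HP]] [E [HE HQ]]; exists (fun z => D z \/ E z); split.
  - now apply dec_or.
  - intros x; rewrite HP, HQ; split; [intros [[k H]|[k H]] | intros [k [H|H]]]; eauto.
Qed.

Lemma sig_ex A (P : nat -> nat -> Prop) :
  Sig A (fun z => P (pi1 z) (pi2 z)) -> Sig A (fun x => exists k, P x k).
Proof.
  intros [D [HD HP]].
  exists (fun z => D <<<<pi1 z, pi1 (pi2 z)>>, pi2 (pi2 z)>>); split.
  - apply (dec_app HD); repeat first [apply rec_pair | apply rec_id | apply rec_pi1 | apply rec_pi2].
  - intros x; split.
    + intros [k Hk]; specialize (HP <<x, k>>); autorewrite with pi in HP.
      apply HP in Hk as [j Hj]; exists <<k, j>>; now autorewrite with pi.
    + intros [k Hk]; autorewrite with pi in Hk; exists (pi1 (pi2 <<x, k>>)).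
      specialize (HP <<x, pi1 k>>); autorewrite with pi in *; apply HP; eauto.
Qed.

(** * Finite sequences and lists of natural numbers *)

Lemma nat_rect_shift (X : Type) (f : X -> X) a n :
  nat_rect (fun _ => X) a (fun _ r => f r) (S n) =
  nat_rect (fun _ => X) (f a) (fun _ r => f r) n.
Proof. induction n as [|n IH]; [reflexivity|]; cbn in *; now rewrite IH. Qed.

(** Every number codes an infinite sequence, read off by iterating [pi2]. No length is stored: a
    finite sequence is obtained by constraining finitely many terms. *)
Definition seqn (L i : nat) : nat :=
  pi1 (nat_rect (fun _ => nat) L (fun _ r => pi2 r) i).

Lemma seqn_0 a L : seqn <<a, L>> 0 = a.
Proof. apply pi1_pair. Qed.

Lemma seqn_S a L i : seqn <<a, L>> (S i) = seqn L i.
Proof. unfold seqn; now rewrite (nat_rect_shift pi2), pi2_pair. Qed.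

(** Finite choice into a single number; this is what moves a bounded universal quantifier inside an
    existential one. *)
Lemma seqn_choice (P : nat -> nat -> Prop) n :
  (forall i, i < n -> exists k, P i k) -> exists L, forall i, i < n -> P i (seqn L i).
Proof.
  revert P; induction n as [|n IH]; intros P H; [exists 0; lia|].
  destruct (H 0) as [a Ha]; [lia|].
  destruct (IH (fun i => P (S i))) as [L HL]; [intros i Hi; apply H; lia|].
  exists <<a, L>>; intros [|i] Hi; [now rewrite seqn_0|].
  rewrite seqn_S; apply HL; lia.
Qed.

Lemma rec_seqn A f g : Rec A f -> Rec A g -> Rec A (fun x => seqn (f x) (g x)).
Proof.
  intros Hf Hg; apply rec_pi1, (rec_nat_rect (a := f) (fun _ _ r => pi2 r));
    [exact Hf | apply rec_pi2, rec_pi2, rec_pi2, rec_id | exact Hg].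
Qed.

Lemma sig_all A (P : nat -> nat -> Prop) k :
  Sig A (fun z => P (pi1 z) (pi2 z)) -> Rec A k ->
  Sig A (fun x => forall i, i < k x -> P x i).
Proof.
  intros [D [HD HP]] Hk.
  exists (fun z => forall i, i < k (pi1 z) -> D <<<<pi1 z, i>>, seqn (pi2 z) i>>); split.
  - apply (dec_all (fun z i => D <<<<pi1 z, i>>, seqn (pi2 z) i>>)).
    + apply (dec_app HD);
        repeat first [apply rec_pair | apply rec_seqn | apply rec_id | apply rec_pi1 | apply rec_pi2].
    + apply (rec_app Hk), rec_pi1, rec_id.
  - intros x; assert (HP' : forall i, P x i <-> exists j, D <<<<x, i>>, j>>).
    { intros i; specialize (HP <<x, i>>); now autorewrite with pi in HP. }
    split.
    + intros H; destruct (seqn_choice (fun i j => D <<<<x, i>>, j>>) (n := k x)) as [L HL].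
      * intros i Hi; now apply HP', H.
      * exists L; now autorewrite with pi.
    + intros [L HL] i Hi; autorewrite with pi in HL; apply HP'; eauto.
Qed.
Ltac rec_atom := fail.

Ltac rec :=
  repeat (cbv beta;
  match goal with
  | H : ?G |- ?G => exact H
  | |- Rec ?A S => exact (rec_S (rec_id A))
  | |- Rec ?A pi1 => exact (rec_pi1 (rec_id A))
  | |- Rec ?A pi2 => exact (rec_pi2 (rec_id A))
  | |- Rec _ (fun x => x) => apply rec_id
  | |- Rec _ (fun _ => ?n) => apply rec_const
  | |- Rec _ (fun x => S _) => apply rec_S
  | |- Rec _ (fun x => pi1 _) => apply rec_pi1
  | |- Rec _ (fun x => pi2 _) => apply rec_pi2
  | |- Rec _ (fun x => Cantor.to_nat (_, _)) => apply rec_pair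
  | |- Rec _ (fun x => _ + _) => apply rec_add
  | |- Rec _ (fun x => _ - _) => apply rec_sub
  | |- Rec _ (fun x => pred _) => apply rec_pred
  | |- Rec _ (fun x => seqn _ _) => apply rec_seqn
  | |- Rec _ (fun x => @nat_rect (fun _ => nat) (@?a x) (@?b x) (@?k x)) =>
      apply (@rec_nat_rect _ a b k)
  | |- Rec _ (fun x => @nat_rect (fun _ => nat) (@?a x) ?b (@?k x)) =>
      apply (@rec_nat_rect _ a (fun _ => b) k)
  | H : Rec ?A ?f |- Rec ?A (fun x => ?f _) => apply (rec_app H)
  | H : Dec ?A ?P |- Dec ?A (fun x => ?P _) => apply (dec_app H)
  | H : Sig ?A ?P |- Sig ?A (fun x => ?P _) => apply (sig_app H)
  | |- Dec _ (fun x => @?f x = @?g x) => apply dec_eq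
  | |- Dec _ (fun x => _ < _) => apply dec_lt
  | |- Dec _ (fun x => _ <= _) => apply dec_le
  | |- Dec _ (fun x => ~ _) => apply dec_not
  | |- Dec _ (fun x => _ /\ _) => apply dec_and
  | |- Dec _ (fun x => _ \/ _) => apply dec_or
  | |- Dec _ (fun x => forall i, i < @?k x -> @?P x i) => apply (dec_all P)
  | |- Dec _ (fun x => exists i, i < @?k x /\ @?P x i) => apply (dec_ex P)
  | |- Dec _ (fun x => @?P x -> @?Q x) => apply (@dec_imp _ P Q)
  | |- Sig _ (fun x => _ /\ _) => apply sig_and
  | |- Sig _ (fun x => _ \/ _) => apply sig_or
  | |- Sig _ (fun x => exists k, @?P x k) => apply (sig_ex P)
  | |- Sig _ (fun x => forall i, i < @?k x -> @?P x i) => apply (sig_all P)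
  | |- Sig _ (fun x => @?f x = @?g x) => apply sig_dec
  | |- Sig _ (fun x => _ < _) => apply sig_dec
  | |- Sig _ (fun x => _ <= _) => apply sig_dec
  | |- Sig _ (fun x => ~ _) => apply sig_dec
  | |- _ => rec_atom
  end).

(** * Normal form of programs *)

(** The classes in which every [eval B c] can be defined by induction on [c].
    The instance [Sig A], with [B = A], gives the semidecidability of evaluation,
    and [Sig2 A], with [B = jump A], gives Post's theorem. *)
Record sigma_class (A : nat -> Prop) (S : (nat -> Prop) -> Prop) : Prop := {
  class_ext : forall P Q, (forall x, P x <-> Q x) -> S P -> S Q;
  class_dec : forall P, Dec A P -> S P;
  class_app : forall P f, S P -> Rec A f -> S (fun x => P (f x));
  class_and : forall P Q, S P -> S Q -> S (fun x => P x /\ Q x);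
  class_ex : forall P : nat -> nat -> Prop,
    S (fun z => P (pi1 z) (pi2 z)) -> S (fun x => exists k, P x k);
  class_all : forall (P : nat -> nat -> Prop) k,
    S (fun z => P (pi1 z) (pi2 z)) -> Rec A k -> S (fun x => forall i, i < k x -> P x i)
}.

Lemma sigma_class_sig A : sigma_class A (Sig A).
Proof.
  split; [apply sig_ext | apply sig_dec | apply sig_app | apply sig_and | apply sig_ex
         | intros P k; apply sig_all].
Qed.

(** Recursion is replaced by the existence of a sequence of intermediate values, a form to which the
    closure properties of a sigma class apply. *)
Lemma eval_prec_seqn A a b x k y :
  eval A (cPrec a b) <<x, k>> y <->
  exists L, eval A a x (seqn L 0) /\
    (forall i, i < k -> eval A b <<x, <<i, seqn L i>>>> (seqn L (S i))) /\ y = seqn L k.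
Proof.
  split.
  - intros H.
    assert (E : exists f : nat -> nat, eval A a x (f 0) /\
      (forall i, i < k -> eval A b <<x, <<i, f i>>>> (f (S i))) /\ y = f k).
    { revert y H; induction k as [|k IH]; intros y H.
      - exists (fun _ => y); apply eval_prec_0 in H; repeat split; [exact H | lia].
      - apply eval_prec_S in H as (r & Hr & Hy); destruct (IH _ Hr) as (f & H0 & HS & ->).
        exists (fun i => if i <=? k then f i else y); repeat split.
        + exact H0.
        + intros i Hi; rewrite (leb_correct i k) by lia.
          destruct (Nat.leb_spec (S i) k); [apply HS; lia|].
          now replace i with k by lia.
        + now rewrite leb_correct_conv by lia. }
    destruct E as (f & H0 & HS & ->).
    destruct (@seqn_choice (fun i v => v = f i) (S k)) as [L HL]; [now eauto|].
    exists L; rewrite !HL by lia; repeat split; [exact H0|].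
    intros i Hi; rewrite !HL by lia; now apply HS.
  - intros (L & H0 & HS & ->).
    induction k as [|k IH]; [rewrite eval_prec_0; exact H0|].
    rewrite eval_prec_S; exists (seqn L k); split; [|apply HS; lia].
    apply IH; intros i Hi; apply HS; lia.
Qed.

(** Each constructor other than [cOracle] is covered by closure properties of the class. The oracle
    query is the only place where [A] and [B] meet, so it is left as a hypothesis. *)
Lemma eval_class A B S (HS : sigma_class A S)
  (Horacle : S (fun z => eval B cOracle (pi1 z) (pi2 z))) c :
  S (fun z => eval B c (pi1 z) (pi2 z)).
Proof.
  destruct HS as [Hext Hdec Happ Hand Hex Hall].
  assert (Happ2 : forall (R : nat -> nat -> Prop) f g, S (fun z => R (pi1 z) (pi2 z)) ->
    Rec A f -> Rec A g -> S (fun x => R (f x) (g x))).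
  { intros R f g HR Hf Hg.
    apply Hext with (fun x => R (pi1 <<f x, g x>>) (pi2 <<f x, g x>>)).
    - intros x; now autorewrite with pi.
    - apply (Happ _ (fun x => <<f x, g x>>) HR); rec. }
  induction c as [| | | | |a IHa b IHb|a IHa b IHb|a IHa b IHb|a IHa].
  - apply Hdec; cbn; rec.
  - apply Hdec; cbn; rec.
  - apply Hdec; change (Dec A (fun z => pi2 z = pi1 (pi1 z))); rec.
  - apply Hdec; change (Dec A (fun z => pi2 z = pi2 (pi1 z))); rec.
  - exact Horacle.
  - cbn; apply Hex, Hex, Hand; [|apply Hand]; cbv beta.
    + apply (Happ2 (eval B a)); [exact IHa | rec | rec].
    + apply (Happ2 (eval B b)); [exact IHb | rec | rec].
    + apply Hdec; rec.
  - cbn; apply Hex, Hand; cbv beta; [apply (Happ2 (eval B b)) | apply (Happ2 (eval B a))];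
      trivial; rec.
  - apply Hext with (fun z => exists L, eval B a (pi1 (pi1 z)) (seqn L 0) /\
      (forall i, i < pi2 (pi1 z) ->
        eval B b <<pi1 (pi1 z), <<i, seqn L i>>>> (seqn L (Datatypes.S i))) /\
      pi2 z = seqn L (pi2 (pi1 z))).
    { intros z; rewrite <- eval_prec_seqn; now rewrite pair_pi. }
    apply Hex, Hand; [|apply Hand]; cbv beta.
    + apply (Happ2 (eval B a)); [exact IHa | rec | rec].
    + apply Hall; [|rec]; cbv beta.
      apply (Happ2 (eval B b)); [exact IHb | rec | rec].
    + apply Hdec; rec.
  - cbn; apply Hand; cbv beta.
    + apply (Happ2 (eval B a)); [exact IHa | rec | rec].
    + apply Hall; [|rec]; apply Hex; cbv beta.
      apply (Happ2 (eval B a)); [exact IHa | rec | rec].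
Qed.

Lemma rec_oracle A : exists f, Rec A f /\ forall x, (A x /\ f x = 1) \/ (~ A x /\ f x = 0).
Proof.
  exists (fun x => if excluded_middle_informative (A x) then 1 else 0); split.
  - exists cOracle; intros x y; cbn; destruct excluded_middle_informative; intuition.
  - intros x; destruct excluded_middle_informative; auto.
Qed.

Lemma dec_oracle A f : Rec A f -> Dec A (fun x => A (f x)).
Proof.
  intros Hf; destruct (rec_oracle A) as (g & Hg & E); exists (fun x => 1 - g (f x)); split.
  - rec.
  - intros x; destruct (E (f x)) as [[]|[]]; split; [lia | trivial | tauto | lia].
Qed.

Lemma sig_app2 A (R : nat -> nat -> Prop) f g :
  Sig A (fun z => R (pi1 z) (pi2 z)) -> Rec A f -> Rec A g -> Sig A (fun x => R (f x) (g x)).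
Proof.
  intros HR Hf Hg; apply sig_ext with (fun x => R (pi1 <<f x, g x>>) (pi2 <<f x, g x>>)).
  - intros x; now autorewrite with pi.
  - apply (sig_app (f := fun x => <<f x, g x>>) HR); rec.
Qed.

Lemma dec_app2 A (R : nat -> nat -> Prop) f g :
  Dec A (fun z => R (pi1 z) (pi2 z)) -> Rec A f -> Rec A g -> Dec A (fun x => R (f x) (g x)).
Proof.
  intros HR Hf Hg; apply dec_ext with (fun x => R (pi1 <<f x, g x>>) (pi2 <<f x, g x>>)).
  - intros x; now autorewrite with pi.
  - apply (dec_app (f := fun x => <<f x, g x>>) HR); rec.
Qed.

Lemma sig_eval A c f g : Rec A f -> Rec A g -> Sig A (fun x => eval A c (f x) (g x)).
Proof.
  apply (sig_app2 (eval A c)), (eval_class A (sigma_class_sig A)).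
  apply sig_dec; cbn [eval].
  rec; apply dec_oracle; rec.
Qed.

(** Selection of one value of a semidecidable relation: among the possibly many values at [x], the
    one returned comes from the least code of a pair of value and witness. *)
Lemma uniformize A (R : nat -> nat -> Prop) : Sig A (fun z => R (pi1 z) (pi2 z)) ->
  exists c, forall x,
    (forall y, eval A c x y -> R x y) /\ ((exists y, R x y) -> exists y, eval A c x y).
Proof.
  intros (D & (f & Hf & HD) & HR).
  assert (Hg : Rec A (fun z => f <<<<pi1 z, pi1 (pi2 z)>>, pi2 (pi2 z)>>)) by rec.
  destruct Hg as [c Hc].
  assert (HR' : forall x y, R x y <-> exists k, f <<<<x, y>>, k>> = 0).
  { intros x y; specialize (HR <<x, y>>); autorewrite with pi in HR; rewrite HR.
    split; intros [k Hk]; exists k; now apply HD. }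
  (* The value and its witness are searched together, so that no search gets stuck on a value
     without witness; [cFst] then drops the witness. *)
  exists (cComp cFst (cMu c)); intros x; split.
  - intros y (w & [Hw _] & Hy); apply eval_fst in Hy as ->.
    apply Hc in Hw; autorewrite with pi in Hw; apply HR'; eauto.
  - intros [y Hy]; apply HR' in Hy as [k Hk].
    destruct (dec_inh_nat_subset_has_unique_least_element
      (fun w => f <<<<x, pi1 w>>, pi2 w>> = 0)) as (w & [Hw Hmin] & _).
    + intros w; destruct (Nat.eq_dec (f <<<<x, pi1 w>>, pi2 w>>) 0); auto.
    + exists <<y, k>>; now autorewrite with pi.
    + exists (pi1 w), w; split; [|now apply eval_fst]; split.
      * apply Hc; now autorewrite with pi.
      * intros m Hm; exists (pred (f <<<<x, pi1 m>>, pi2 m>>)).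
        apply Hc; autorewrite with pi.
        assert (f <<<<x, pi1 m>>, pi2 m>> <> 0) by (intros E; apply Hmin in E; lia).
        lia.
Qed.

Lemma rec_graph A f : Sig A (fun z => pi2 z = f (pi1 z)) -> Rec A f.
Proof.
  intros H; destruct (uniformize (fun x y => y = f x) H) as [c Hc].
  exists c; intros x y; destruct (Hc x) as [H1 H2]; split; [apply H1|].
  intros ->; destruct H2 as [y Hy]; [now exists (f x)|]; now rewrite <- (H1 _ Hy).
Qed.

Lemma eval_det A c x y y' : eval A c x y -> eval A c x y' -> y = y'.
Proof.
  revert x y y'; induction c as [| | | | |a IHa b IHb|a IHa b IHb|a IHa b IHb|a IHa];
    intros x y y'; cbn [eval]; try congruence; try tauto.
  - intros [[]|[]] [[]|[]]; subst; tauto.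
  - intros (u & v & Hu & Hv & ->) (u' & v' & Hu' & Hv' & ->).
    now rewrite (IHa _ _ _ Hu Hu'), (IHb _ _ _ Hv Hv').
  - intros (u & Hu & Hy) (u' & Hu' & Hy'); rewrite (IHb _ _ _ Hu Hu') in Hy; eauto.
  - revert y y'; induction (snd (Cantor.of_nat x)) as [|n IH]; intros y y'; cbn; [apply IHa|].
    intros (r & Hr & Hy) (r' & Hr' & Hy'); rewrite (IH _ _ Hr Hr') in Hy; eauto.
  - intros [H0 H] [H0' H']; destruct (Nat.lt_trichotomy y y') as [Hl|[E|Hl]]; trivial.
    + destruct (H' y Hl) as [k Hk]; discriminate (IHa _ _ _ H0 Hk).
    + destruct (H y' Hl) as [k Hk]; discriminate (IHa _ _ _ H0' Hk).
Qed.

(** * Codes of finite lists *)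

Fixpoint lnum (l : list nat) : nat :=
  match l with
  | [] => 0
  | a :: l => S <<a, lnum l>>
  end.

(** The successor in [lnum] leaves 0 to the empty list, so search over numbers is search over lists.
    The numbering of finite functions has the same shape. *)
Lemma lnum_surj n : exists l, lnum l = n.
Proof.
  induction n as [[|n] IH] using lt_wf_ind; [now exists []|].
  destruct (IH (pi2 n)) as [l Hl]; [pose proof (pi2_le n); lia|].
  exists (pi1 n :: l); cbn; now rewrite Hl, pair_pi.
Qed.

Definition tail (n : nat) : nat := pi2 (pred n).
Definition drop (n i : nat) : nat := nat_rect (fun _ => nat) n (fun _ r => tail r) i.
Definition head (n : nat) : nat := pi1 (pred n).
(** A nonzero [drop n i] means that position [i] lies inside the list. The bound [i < n] loses
    nothing by [drop_lt], and it makes membership decidable. *)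
Definition mem (a n : nat) : Prop := exists i, i < n /\ (drop n i <> 0 /\ head (drop n i) = a).

Lemma head_cons a m : head (S <<a, m>>) = a.
Proof. apply pi1_pair. Qed.

Lemma tail_cons a m : tail (S <<a, m>>) = m.
Proof. apply pi2_pair. Qed.

Lemma drop_0 n : drop n 0 = n.
Proof. reflexivity. Qed.

Lemma drop_S n i : drop n (S i) = drop (tail n) i.
Proof. apply (nat_rect_shift tail). Qed.

Lemma drop_lt n i : drop n i <> 0 -> i < n.
Proof.
  revert n; induction i as [|i IH]; intros n H; [cbn in H; lia|].
  rewrite drop_S in H; apply IH in H.
  unfold tail in H; pose proof (pi2_le (pred n)); lia.
Qed.

Lemma mem_lnum a l : mem a (lnum l) <-> In a l.
Proof.
  induction l as [|b l IH]; cbn [lnum In]; [split; [intros (i & Hi & _); lia | tauto]|].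
  rewrite <- IH; split.
  - intros ([|i] & Hi & Hd & Ha); [left; now rewrite <- Ha, drop_0, head_cons|].
    right; rewrite drop_S, tail_cons in *; exists i; auto using drop_lt.
  - intros [->|(i & Hi & Hd & Ha)].
    + exists 0; repeat split; [lia | discriminate | apply head_cons].
    + exists (S i); rewrite drop_S, tail_cons; repeat split; trivial.
      pose proof (pair_le b (lnum l)); lia.
Qed.

Lemma mem_lt a n : mem a n -> a < n.
Proof.
  destruct (lnum_surj n) as [l <-]; rewrite mem_lnum.
  induction l as [|b l IH]; [easy|]; cbn [lnum]; pose proof (pair_le b (lnum l)).
  intros [->|Ha]; [lia | apply IH in Ha; lia].
Qed.

Lemma rec_tail A f : Rec A f -> Rec A (fun x => tail (f x)).
Proof. intros Hf; unfold tail; rec. Qed.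

Lemma rec_head A f : Rec A f -> Rec A (fun x => head (f x)).
Proof. intros Hf; unfold head; rec. Qed.

Lemma rec_drop A f g : Rec A f -> Rec A g -> Rec A (fun x => drop (f x) (g x)).
Proof. intros Hf Hg; unfold drop, tail; rec. Qed.

Lemma dec_mem A f g : Rec A f -> Rec A g -> Dec A (fun x => mem (f x) (g x)).
Proof.
  intros Hf Hg; unfold mem; repeat first [apply rec_drop | apply rec_head | progress rec].
Qed.

Ltac rec_atom ::=
  match goal with
  | |- Rec _ (fun x => drop _ _) => apply rec_drop
  | |- Rec _ (fun x => tail _) => apply rec_tail
  | |- Rec _ (fun x => head _) => apply rec_head
  | |- Dec _ (fun x => mem _ _) => apply dec_mem
  | |- Sig _ (fun x => mem _ _) => apply sig_dec, dec_mem
  end.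

(** * Derivations and the universal program *)

(** A derivation is a list in which each entry follows by [rule] from the
    entries after it. *)

Section Derivations.

Variable rule : nat -> (nat -> Prop) -> Prop.

Fixpoint closed (l : list nat) : Prop :=
  match l with
  | [] => True
  | f :: l => rule f (fun a => In a l) /\ closed l
  end.

Definition derivable (f : nat) : Prop := exists l, In f l /\ closed l.

Lemma derivable_ind (T : nat -> Prop) :
  (forall f M, rule f M -> (forall a, M a -> T a) -> T f) -> forall f, derivable f -> T f.
Proof.
  intros HT f [l [Hf Hl]]; revert f Hf Hl.
  induction l as [|g l IH]; [easy|].
  intros f [->|Hf] [Hg Hl]; eauto.
Qed.

Hypothesis rule_mono :
  forall f (M M' : nat -> Prop), (forall a, M a -> M' a) -> rule f M -> rule f M'.

Lemma closed_app l l' : closed l -> closed l' -> closed (l ++ l').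
Proof.
  intros Hl Hl'; induction l as [|f l IH]; [exact Hl'|].
  destruct Hl as [Hf Hl]; split; [|auto].
  revert Hf; apply rule_mono; intros a Ha; apply in_or_app; now left.
Qed.

(** Derivations of the finitely many premises are concatenated; by monotonicity each entry stays
    justified when more entries follow it. *)
Lemma derivable_rule l f :
  (forall a, In a l -> derivable a) -> rule f (fun a => In a l) -> derivable f.
Proof.
  intros Hl Hf.
  assert (E : exists L, closed L /\ incl l L).
  { clear Hf; induction l as [|a l IH]; [exists []; split; [exact I | easy]|].
    destruct IH as (L & HL & Hi); [intros b Hb; apply Hl; now right|].
    destruct (Hl a) as (L' & Ha & HL'); [now left|].
    exists (L' ++ L); split; [now apply closed_app|].
    apply incl_cons; [apply in_or_app; now left|].
    now apply incl_appr. }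
  destruct E as (L & HL & Hi); exists (f :: L); split; [now left|]; split; [|exact HL].
  now apply (rule_mono (M := fun a => In a l)).
Qed.

(** Entries are addressed by position, with the code itself as bound; the positions past the end are
    those with [drop n i = 0]. *)
Definition closed_code (n : nat) : Prop := forall i, i < n ->
  drop n i = 0 \/ rule (head (drop n i)) (fun a => mem a (tail (drop n i))).

Lemma closed_lnum l : closed_code (lnum l) <-> closed l.
Proof.
  unfold closed_code; induction l as [|g l IH]; cbn [closed lnum]; [split; [trivial | lia]|].
  rewrite <- IH; clear IH.
  replace (fun a => In a l) with (fun a => mem a (lnum l))
    by (extensionality a; apply propositional_extensionality, mem_lnum).
  split.
  - intros H; split.
    + specialize (H 0); rewrite drop_0, head_cons, tail_cons in H.
      destruct H; [lia | discriminate | trivial].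
    + intros i Hi; specialize (H (S i)); rewrite drop_S, tail_cons in H.
      apply H; pose proof (pair_le g (lnum l)); lia.
  - intros [Hg H] [|i] Hi; [right; now rewrite drop_0, head_cons, tail_cons|].
    rewrite drop_S, tail_cons.
    destruct (Nat.eq_dec (drop (lnum l) i) 0); [now left|]; auto using drop_lt.
Qed.

Lemma sig_derivable A f : Sig A (fun z => rule (pi1 z) (fun a => mem a (pi2 z))) ->
  Rec A f -> Sig A (fun x => derivable (f x)).
Proof.
  intros Hrule Hf; apply sig_ext with (fun x => exists n, mem (f x) n /\ closed_code n).
  - intros x; split.
    + intros (n & Hm & H); destruct (lnum_surj n) as [l <-].
      exists l; split; [now apply mem_lnum | now apply closed_lnum].
    + intros (l & Hm & H); exists (lnum l); split; [now apply mem_lnum | now apply closed_lnum].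
  - unfold closed_code; rec.
    apply (sig_app2 (fun f n => rule f (fun a => mem a n))); [exact Hrule | rec | rec].
Qed.

End Derivations.

(** * Evaluation by derivations and the enumeration theorem *)

(** A fact [<<n, <<x, y>>>>] means that program [n] sends [x] to [y], and [M] holds the facts
    already obtained. The tags 0 to 8 are those of [code_num]; tag 7 occurs twice, for the base and
    the step of a recursion, and the step appeals to the same [n] at a smaller argument. *)
Definition eval_rule (A : nat -> Prop) (n x y : nat) (M : nat -> Prop) : Prop :=
  (pi1 n = 0 /\ y = 0) \/ (pi1 n = 1 /\ y = S x) \/
  (pi1 n = 2 /\ y = pi1 x) \/ (pi1 n = 3 /\ y = pi2 x) \/
  (pi1 n = 4 /\ ((A x /\ y = 1) \/ (~ A x /\ y = 0))) \/
  (pi1 n = 5 /\ exists u v,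
     M <<pi1 (pi2 n), <<x, u>>>> /\ M <<pi2 (pi2 n), <<x, v>>>> /\ y = <<u, v>>) \/
  (pi1 n = 6 /\ exists u, M <<pi2 (pi2 n), <<x, u>>>> /\ M <<pi1 (pi2 n), <<u, y>>>>) \/
  (pi1 n = 7 /\ pi2 x = 0 /\ M <<pi1 (pi2 n), <<pi1 x, y>>>>) \/
  (pi1 n = 7 /\ exists m r, pi2 x = S m /\ M <<n, <<<<pi1 x, m>>, r>>>> /\
     M <<pi2 (pi2 n), <<<<pi1 x, <<m, r>>>>, y>>>>) \/
  (pi1 n = 8 /\ M <<pi2 n, <<<<x, y>>, 0>>>> /\
     forall m, m < y -> exists r, M <<pi2 n, <<<<x, m>>, S r>>>>).

(** For the basic programs [eval_rule] looks at the tag only, so it also derives facts about numbers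
    that code no program. Being a code is therefore checked separately, again by derivations. *)
Definition code_rule (n : nat) (M : nat -> Prop) : Prop :=
  (pi1 n <= 4 /\ pi2 n = 0) \/
  (5 <= pi1 n /\ pi1 n <= 7 /\ M (pi1 (pi2 n)) /\ M (pi2 (pi2 n))) \/
  (pi1 n = 8 /\ M (pi2 n)).

Definition evaluates (A : nat -> Prop) (f : nat) : Prop :=
  derivable (fun f => eval_rule A (pi1 f) (pi1 (pi2 f)) (pi2 (pi2 f))) f.

Lemma evaluates_sound A n x y : evaluates A <<n, <<x, y>>>> ->
  forall c, code_num c = n -> eval A c x y.
Proof.
  intros H.
  enough (forall c, code_num c = pi1 <<n, <<x, y>>>> ->
    eval A c (pi1 (pi2 <<n, <<x, y>>>>)) (pi2 (pi2 <<n, <<x, y>>>>))) as E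
    by (now autorewrite with pi in E).
  revert H; generalize <<n, <<x, y>>>>.
  apply (derivable_ind (fun f =>
    forall c, code_num c = pi1 f -> eval A c (pi1 (pi2 f)) (pi2 (pi2 f)))).
  intros f M Hf HM.
  assert (HM' : forall n' x' y' c, M <<n', <<x', y'>>>> -> code_num c = n' -> eval A c x' y').
  { intros n' x' y' c HMn; specialize (HM _ HMn c); now autorewrite with pi in HM. }
  clear HM; revert Hf HM'; generalize (pi1 f) (pi1 (pi2 f)) (pi2 (pi2 f)); clear.
  intros n x y H HM c <-; unfold eval_rule in H.
  destruct c; cbn [code_num] in H; autorewrite with pi in H;
    destruct H as [[K H]|[[K H]|[[K H]|[[K H]|[[K H]|[[K H]|[[K H]|[[K H]|[[K H]|[K H]]]]]]]]]];
    try discriminate; try exact H.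
  - destruct H as (u & v & Hu & Hv & ->); exists u, v; eauto.
  - destruct H as (u & Hu & Hv); exists u; eauto.
  - destruct H as [Hx Hy]; rewrite <- (pair_pi x), Hx, eval_prec_0; eauto.
  - destruct H as (m & r & Hx & Hr & Hy); rewrite <- (pair_pi x), Hx, eval_prec_S.
    exists r; eauto.
  - destruct H as [H0 H]; split; [eauto|].
    intros m Hm; destruct (H m Hm) as [r Hr]; exists r; eauto.
Qed.

Lemma eval_rule_mono A n x y (M M' : nat -> Prop) :
  (forall a, M a -> M' a) -> eval_rule A n x y M -> eval_rule A n x y M'.
Proof.
  intros E H; unfold eval_rule in *.
  do 9 (destruct H as [H|H]; [left; firstorder|right]); firstorder.
Qed.

Lemma evaluates_complete A c x y : eval A c x y -> evaluates A <<code_num c, <<x, y>>>>.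
Proof.
  assert (R : forall l n x y, (forall a, In a l -> evaluates A a) ->
    eval_rule A n x y (fun a => In a l) -> evaluates A <<n, <<x, y>>>>).
  { intros l n x' y' Hl H; refine (derivable_rule _ l _ Hl _).
    - intros f; apply eval_rule_mono.
    - now autorewrite with pi. }
  revert x y; induction c as [| | | | |a IHa b IHb|a IHa b IHb|a IHa b IHb|a IHa];
    intros x y H; cbn [code_num].
  - apply (R []); [easy|]; unfold eval_rule; autorewrite with pi; auto.
  - apply (R []); [easy|]; unfold eval_rule; autorewrite with pi; auto.
  - apply (R []); [easy|]; unfold eval_rule; autorewrite with pi; auto 6.
  - apply (R []); [easy|]; unfold eval_rule; autorewrite with pi; auto 6.
  - apply (R []); [easy|]; unfold eval_rule; autorewrite with pi; auto 7.
  - destruct H as (u & v & Hu & Hv & ->).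
    apply (R [<<code_num a, <<x, u>>>>; <<code_num b, <<x, v>>>>]).
    + intros d [<-|[<-|[]]]; auto.
    + unfold eval_rule; autorewrite with pi; do 5 right; left.
      split; [reflexivity|]; exists u, v; cbn; auto.
  - destruct H as (u & Hu & Hy).
    apply (R [<<code_num b, <<x, u>>>>; <<code_num a, <<u, y>>>>]).
    + intros d [<-|[<-|[]]]; auto.
    + unfold eval_rule; autorewrite with pi; do 6 right; left.
      split; [reflexivity|]; exists u; cbn; auto.
  - rewrite <- (pair_pi x) in *; revert y H; generalize (pi1 x) as x0.
    induction (pi2 x) as [|n IH]; intros x0 y H.
    + apply eval_prec_0 in H; apply (R [<<code_num a, <<x0, y>>>>]).
      * intros d [<-|[]]; auto.
      * unfold eval_rule; autorewrite with pi; do 7 right; left; cbn; auto.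
    + apply eval_prec_S in H as (r & Hr & Hy); set (p := <<7, <<code_num a, code_num b>>>>) in *.
      apply (R [<<p, <<<<x0, n>>, r>>>>; <<code_num b, <<<<x0, <<n, r>>>>, y>>>>]).
      * intros d [<-|[<-|[]]]; auto.
      * unfold eval_rule, p; autorewrite with pi; do 8 right; left.
        split; [reflexivity|]; exists n, r; cbn; auto.
  - destruct H as [H0 H].
    (* The number of premises of a [cMu] fact grows with its value [y], so their list is built by
       induction on [y]. *)
    assert (E : exists l, (forall d, In d l -> evaluates A d) /\
      forall m, m < y -> exists r, In <<code_num a, <<<<x, m>>, S r>>>> l).
    { clear H0; induction y as [|y IH]; [exists []; split; [easy | lia]|].
      destruct IH as (l & Hl & Hm); [intros m Hm; apply H; lia|].
      destruct (H y) as [r Hr]; [lia|].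
      exists (<<code_num a, <<<<x, y>>, S r>>>> :: l); split.
      - intros d [<-|Hd]; auto.
      - intros m Hm'; destruct (Nat.eq_dec m y) as [->|]; [exists r; now left|].
        destruct (Hm m) as [r' Hr']; [lia|]; exists r'; now right. }
    destruct E as (l & Hl & Hm).
    apply (R (<<code_num a, <<<<x, y>>, 0>>>> :: l)).
    + intros d [<-|Hd]; auto.
    + unfold eval_rule; autorewrite with pi; do 9 right.
      split; [reflexivity|]; split; [now left|].
      intros m Hm'; destruct (Hm m Hm') as [r Hr]; exists r; now right.
Qed.

Lemma derivable_code_rule n : derivable code_rule n <-> exists c, code_num c = n.
Proof.
  split.
  - revert n; apply derivable_ind; intros n M H HM; rewrite <- (pair_pi n).
    destruct H as [[Hk Hn]|[(Hk & Hk' & Ha & Hb)|[Hk Ha]]].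
    + rewrite Hn; destruct (pi1 n) as [|[|[|[|[|k]]]]]; [| | | | |lia];
        [exists cZero | exists cSucc | exists cFst | exists cSnd | exists cOracle]; reflexivity.
    + destruct (HM _ Ha) as [a Ea], (HM _ Hb) as [b Eb].
      rewrite <- (pair_pi (pi2 n)), <- Ea, <- Eb.
      assert (pi1 n = 5 \/ pi1 n = 6 \/ pi1 n = 7) as [->|[->| ->]] by lia;
        [exists (cPair a b) | exists (cComp a b) | exists (cPrec a b)]; reflexivity.
    + destruct (HM _ Ha) as [a Ea]; rewrite Hk, <- Ea; now exists (cMu a).
  - assert (R : forall l n, (forall a, In a l -> derivable code_rule a) ->
      code_rule n (fun a => In a l) -> derivable code_rule n).
    { apply derivable_rule; unfold code_rule; firstorder. }
    intros [c <-]; induction c as [| | | | |a IHa b IHb|a IHa b IHb|a IHa b IHb|a IHa];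
      cbn [code_num].
    1-5: apply (R []); [easy|]; left; autorewrite with pi; lia.
    1-3: apply (R [code_num a; code_num b]); [intros d [<-|[<-|[]]]; assumption|];
      right; left; autorewrite with pi; cbn; repeat split; auto; lia.
    apply (R [code_num a]); [intros d [<-|[]]; assumption|].
    right; right; autorewrite with pi; cbn; auto.
Qed.

Definition universal (A : nat -> Prop) (n x y : nat) : Prop :=
  exists c, code_num c = n /\ eval A c x y.

Lemma universal_evaluates A n x y :
  universal A n x y <-> derivable code_rule n /\ evaluates A <<n, <<x, y>>>>.
Proof.
  rewrite derivable_code_rule; split.
  - intros (c & <- & H); split; [now exists c | now apply evaluates_complete].
  - intros [[c Hc] H]; exists c; split; [exact Hc | now apply evaluates_sound with n].
Qed.

Lemma universal_code A c x y : universal A (code_num c) x y <-> eval A c x y.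
Proof.
  rewrite universal_evaluates; split.
  - intros [_ H]; exact (@evaluates_sound A _ x y H c eq_refl).
  - intros H; split; [apply derivable_code_rule; now exists c | now apply evaluates_complete].
Qed.

Lemma universal_det A n x y y' : universal A n x y -> universal A n x y' -> y = y'.
Proof.
  intros (c & <- & H) H'; apply universal_code in H'; eapply eval_det; eassumption.
Qed.

(** The enumeration theorem: the program is now an argument, whereas it is fixed in [sig_eval]. *)
Lemma sig_universal A f g h :
  Rec A f -> Rec A g -> Rec A h -> Sig A (fun x => universal A (f x) (g x) (h x)).
Proof.
  intros Hf Hg Hh.
  apply sig_ext with (fun x => derivable code_rule (f x) /\ evaluates A <<f x, <<g x, h x>>>>).
  - intros x; now rewrite universal_evaluates.
  - apply sig_and; apply sig_derivable; unfold code_rule, eval_rule; rec;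
    try apply sig_dec; apply dec_oracle; rec.
Qed.
(** * The jump *)

Lemma sig_jump A f : Rec A f -> Sig A (fun x => jump A (f x)).
Proof.
  intros Hf; apply sig_ext with (fun x => exists y, universal A (f x) (f x) y).
  - intros x; split; [intros (y & c & Hc & H) | intros (c & Hc & y & H)].
    + exists c; eauto.
    + exists y, c; eauto.
  - apply sig_ex, sig_universal; rec.
Qed.

Fixpoint const_code (n : nat) : code :=
  match n with
  | 0 => cZero
  | S n => cComp cSucc (const_code n)
  end.

Lemma eval_const_code A n x y : eval A (const_code n) x y <-> y = n.
Proof.
  revert y; induction n as [|n IH]; intros y; cbn; [reflexivity|].
  split; [intros (u & Hu & ->); apply IH in Hu; congruence|].
  intros ->; exists n; now rewrite IH.
Qed.

Lemma rec_const_code A : Rec A (fun n => code_num (const_code n)).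
Proof.
  apply rec_ext with (fun n => nat_rect (fun _ => nat) (code_num cZero)
    (fun _ r => <<6, <<code_num cSucc, r>>>>) n).
  - intros n; induction n as [|n IH]; [reflexivity|].
    transitivity <<6, <<code_num cSucc, code_num (const_code n)>>>>; [now rewrite <- IH | reflexivity].
  - rec.
Qed.

(** The jump only tells whether program [n] halts on input [n]. The number [g x] codes a program
    that ignores its input and searches for a witness of [P x], so being run on its own number does
    no harm. *)
Lemma dec_jump A P : Sig A P -> Dec (jump A) P.
Proof.
  intros (D & (f & [c Hc] & HD) & HP).
  set (g := fun x => <<6, <<code_num (cMu c), code_num (const_code x)>>>>).
  assert (Hg : Rec (jump A) g).
  { pose proof (rec_const_code (jump A)) as H; unfold g; rec. }
  apply dec_ext with (fun x => jump A (g x)); [|now apply dec_oracle].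
  intros x; transitivity (exists y, eval A (cMu c) x y).
  - assert (E : forall y z, eval A (cComp (cMu c) (const_code x)) z y <-> eval A (cMu c) x y).
    { intros y z; cbn [eval]; split.
      - intros (u & Hu & Hy); now apply eval_const_code in Hu as ->.
      - intros Hy; exists x; now rewrite eval_const_code. }
    change (jump A (g x)) with (exists d, code_num d =
      code_num (cComp (cMu c) (const_code x)) /\ exists y, eval A d (g x) y).
    split.
    + intros (d & Hd & y & Hy); exists y; apply (E y (g x)).
      (* Programs with the same number have the same results by [universal_code], which stands in
         for the injectivity of [code_num]. *)
      rewrite <- universal_code, <- Hd; now apply universal_code.
    + intros [y Hy]; eexists; split; [reflexivity|]; exists y; now apply E.
  - rewrite HP; split.
    + intros [y [Hy _]]; apply Hc in Hy; exists y; now apply HD.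
    + intros [k Hk]; apply HD in Hk.
      destruct (dec_inh_nat_subset_has_unique_least_element (fun k => f <<x, k>> = 0))
        as (w & [Hw Hmin] & _).
      * intros w; destruct (Nat.eq_dec (f <<x, w>>) 0); auto.
      * eauto.
      * exists w; split; [now apply Hc|].
        intros m Hm; exists (pred (f <<x, m>>)); apply Hc.
        assert (f <<x, m>> <> 0) by (intros E; apply Hmin in E; lia); lia.
Qed.

(** * Post's theorem *)

Definition Sig2 (A : nat -> Prop) (P : nat -> Prop) : Prop :=
  exists R : nat -> nat -> Prop,
    Sig A (fun z => R (pi1 z) (pi2 z)) /\ forall x, P x <-> exists k, ~ R x k.

Lemma sigma_class_sig2 A : sigma_class A (Sig2 A).
Proof.
  split.
  - intros P Q E (R & HR & HP); exists R; split; [exact HR|].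
    intros x; now rewrite <- E.
  - intros P HP; exists (fun x _ => ~ P x); split; [apply sig_dec; rec|].
    intros x; pose proof (dec_em x HP); firstorder.
  - intros P f (R & HR & HP) Hf; exists (fun x k => R (f x) k); split.
    + apply (sig_app2 R); [exact HR | rec | rec].
    + intros x; apply HP.
  - intros P Q (R & HR & HP) (T & HT & HQ).
    exists (fun x k => R x (pi1 k) \/ T x (pi2 k)); split.
    + rec; [apply (sig_app2 R) | apply (sig_app2 T)]; trivial; rec.
    + intros x; rewrite HP, HQ; split.
      * intros [[k Hk] [l Hl]]; exists <<k, l>>; rewrite pi1_pair, pi2_pair; tauto.
      * intros [k Hk]; split; eexists; intros H; apply Hk; eauto.
  - intros P (R & HR & HP); exists (fun x k => R <<x, pi1 k>> (pi2 k)); split.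
    + apply (sig_app2 R); [exact HR | rec | rec].
    + intros x; split.
      * intros [k Hk]; specialize (HP <<x, k>>); rewrite pi1_pair, pi2_pair in HP.
        apply HP in Hk as [j Hj]; exists <<k, j>>; now autorewrite with pi.
      * intros [k Hk]; exists (pi1 k); specialize (HP <<x, pi1 k>>).
        rewrite pi1_pair, pi2_pair in HP; apply HP; eauto.
  - intros P k (R & HR & HP) Hk.
    (* One number codes a sequence of witnesses, and the sequence is refuted as soon as one of its
       terms is. *)
    exists (fun x L => exists i, i < k x /\ R <<x, i>> (seqn L i)); split.
    + rec; apply (sig_app2 R); [exact HR | rec | rec].
    + intros x; assert (HP' : forall i, P x i <-> exists j, ~ R <<x, i>> j).
      { intros i; specialize (HP <<x, i>>); now rewrite pi1_pair, pi2_pair in HP. }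
      split.
      * intros H; destruct (seqn_choice (fun i j => ~ R <<x, i>> j) (n := k x)) as [L HL].
        -- intros i Hi; now apply HP', H.
        -- exists L; intros (i & Hi & Hr); now apply (HL i Hi).
      * intros [L HL] i Hi; apply HP'; exists (seqn L i); eauto.
Qed.

(** By [eval_class] only oracle queries need attention: the answer 1 is semidecidable in [A], and
    the answer 0 is the complement of such a statement. *)
Lemma sig_jump_sig2 A P : Sig (jump A) P -> Sig2 A P.
Proof.
  intros (D & (f & [c Hc] & HD) & HP).
  pose proof (sigma_class_sig2 A) as HS.
  apply (class_ext HS) with (fun x => exists k, eval (jump A) c <<x, k>> 0).
  { intros x; rewrite HP; split; intros [k Hk]; exists k.
    - now apply HD; symmetry; apply Hc.
    - apply Hc; symmetry; now apply HD. }
  apply (class_ex HS).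
  apply (class_ext HS) with (fun z => eval (jump A) c (pi1 <<z, 0>>) (pi2 <<z, 0>>)).
  { intros z; now autorewrite with pi. }
  apply (class_app HS (fun z => eval (jump A) c (pi1 z) (pi2 z)) (f := fun z => <<z, 0>>));
    [|rec].
  apply (eval_class _ HS).
  destruct (sig_jump (rec_id A)) as (E & HE & HJ).
  (* The negation of this relation reads: stage [k] confirms membership and the answer is 1, or
     membership fails and the answer is 0. The relation itself is semidecidable because [jump A]
     occurs in it positively. *)
  exists (fun z k => ~ (E <<pi1 z, k>> /\ pi2 z = 1) /\ (jump A (pi1 z) \/ ~ pi2 z = 0)); split.
  - rec; apply sig_jump; rec.
  - intros z; cbn [eval]; split.
    + intros [[Hj Hz]|[Hj Hz]].
      * apply HJ in Hj as [k Hk]; exists k; tauto.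
      * exists 0; tauto.
    + intros [k Hk]; destruct (classic (jump A (pi1 z))) as [Hj|Hj]; [left|right].
      * split; [exact Hj|]; apply NNPP; tauto.
      * split; [exact Hj|]; apply NNPP; intros Hz; apply Hk; split; [|now right].
        intros [H _]; apply Hj, HJ; eauto.
Qed.

(** With the empty oracle every query returns 0. Replacing queries by [cZero] makes the result
    independent of the oracle, which carries recursive functions over to every [A]. *)
Fixpoint no_oracle (c : code) : code :=
  match c with
  | cOracle => cZero
  | cPair a b => cPair (no_oracle a) (no_oracle b)
  | cComp a b => cComp (no_oracle a) (no_oracle b)
  | cPrec a b => cPrec (no_oracle a) (no_oracle b)
  | cMu a => cMu (no_oracle a)
  | c => c
  end.

Lemma eval_no_oracle A c : eval A (no_oracle c) = eval emptyset c.
Proof.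
  induction c as [| | | | |a IHa b IHb|a IHa b IHb|a IHa b IHb|a IHa]; cbn;
    rewrite ?IHa, ?IHb; trivial.
  extensionality x; extensionality y; apply propositional_extensionality.
  unfold emptyset; tauto.
Qed.

Lemma rec_emptyset A f : Rec emptyset f -> Rec A f.
Proof. intros [c Hc]; exists (no_oracle c); now rewrite eval_no_oracle. Qed.

(** * Functions and sets of words *)

Lemma num_false (w : word) : num (false :: w) = S (num w + num w).
Proof. change (2 * num w + 1 = S (num w + num w)); lia. Qed.

Lemma num_true (w : word) : num (true :: w) = S (S (num w + num w)).
Proof. change (2 * num w + 2 = S (S (num w + num w))); lia. Qed.

Lemma num_word_inj (w w' : word) : num w = num w' -> w = w'.
Proof.
  revert w'; induction w as [|[] w IH]; intros [|[] w']; rewrite ?num_false, ?num_true;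
    cbn [num num_word]; intros H; try lia; trivial; f_equal; apply IH; lia.
Qed.

Lemma num_word_surj n : exists w : word, num w = n.
Proof.
  induction n as [[|n] IH] using lt_wf_ind; [now exists []|].
  destruct (Nat.Even_or_Odd n) as [[k ->]|[k ->]].
  - destruct (IH k) as [w Hw]; [lia|]; exists (false :: w); rewrite num_false; lia.
  - destruct (IH k) as [w Hw]; [lia|]; exists (true :: w); rewrite num_true; lia.
Qed.

Definition to_word (n : nat) : word :=
  proj1_sig (constructive_indefinite_description _ (num_word_surj n)).

Lemma num_to_word n : num (to_word n) = n.
Proof. apply (proj2_sig (constructive_indefinite_description _ (num_word_surj n))). Qed.

Lemma to_word_num w : to_word (num w) = w.
Proof. apply num_word_inj, num_to_word. Qed.

#[global] Opaque num_word.

Lemma sig_of_partial_recursive A X Y (nX : Numbering X) (nY : Numbering Y) (f : X -> option Y) :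
  partial_recursive A f -> exists R : nat -> nat -> Prop,
    Sig A (fun z => R (pi1 z) (pi2 z)) /\
    forall x n, R (num x) n <-> exists y, f x = Some y /\ n = num y.
Proof. intros [c Hc]; exists (eval A c); split; [apply sig_eval; rec | exact Hc]. Qed.

Lemma partial_recursive_of_sig A X Y (nX : Numbering X) (nY : Numbering Y)
  (f : X -> option Y) (R : nat -> nat -> Prop) :
  Sig A (fun z => R (pi1 z) (pi2 z)) ->
  (forall x n, R (num x) n <-> exists y, f x = Some y /\ n = num y) ->
  partial_recursive A f.
Proof.
  intros HR Hf; destruct (uniformize R HR) as [c Hc]; exists c; intros x n.
  destruct (Hc (num x)) as [H1 H2]; rewrite <- Hf; split; [apply H1|].
  intros H; destruct H2 as [m Hm]; [eauto|].
  enough (m = n) by congruence; apply H1, Hf in Hm; apply Hf in H.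
  destruct Hm as (y & Hy & ->), H as (y' & Hy' & ->); congruence.
Qed.

Lemma partial_recursive_word A (G : word -> option nat) :
  partial_recursive A G <-> Sig A (fun z => G (to_word (pi1 z)) = Some (pi2 z)).
Proof.
  split.
  - intros H; destruct (sig_of_partial_recursive H) as (R & HR & E).
    revert HR; apply sig_ext; intros z.
    rewrite <- (num_to_word (pi1 z)) at 1; rewrite E.
    split; [intros (y & -> & ->); reflexivity | intros H'; now exists (pi2 z)].
  - intros H.
    refine (partial_recursive_of_sig _ _ G (fun x y => G (to_word x) = Some y) H _).
    intros x n; rewrite to_word_num; split; [now exists n | intros (y & -> & ->); reflexivity].
Qed.

Lemma total_recursive_word (phi : word -> word) :
  total_recursive phi <-> Rec emptyset (fun n => num (phi (to_word n))).
Proof.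
  split.
  - intros [c Hc]; exists c; intros x y.
    rewrite <- (num_to_word x) at 1; rewrite Hc; split.
    + intros (w & Hw & ->); now inversion Hw.
    + intros ->; eauto.
  - intros [c Hc]; exists c; intros x n; rewrite Hc, to_word_num; split; [eauto|].
    intros (w & Hw & ->); now inversion Hw.
Qed.

Lemma recursively_enumerable_sig X (nX : Numbering X) (R : X -> Prop) :
  recursively_enumerable R <-> exists N, Sig emptyset N /\ forall x, R x <-> N (num x).
Proof.
  split.
  - intros [c Hc]; exists (fun x => exists n, eval emptyset c x n); split; [|exact Hc].
    apply sig_ex, sig_eval; rec.
  - intros (N & HN & HR).
    destruct (@uniformize emptyset (fun x _ => N x)) as [c Hc]; [rec|].
    exists c; intros x; rewrite HR; destruct (Hc (num x)) as [H1 H2]; split.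
    + intros H; apply H2; now exists 0.
    + intros [n Hn]; now apply H1 in Hn.
Qed.

(** * Self-delimiting prefixes *)

Definition tag (n : nat) (p : word) : word := repeat true n ++ false :: p.

Fixpoint untag (w : word) : nat * word :=
  match w with
  | [] => (0, [])
  | false :: p => (0, p)
  | true :: w => (S (fst (untag w)), snd (untag w))
  end.

Definition tag_index (w : word) : nat := fst (untag w).
Definition tag_word (w : word) : word := snd (untag w).

Lemma tag_index_tag n p : tag_index (tag n p) = n.
Proof. unfold tag_index, tag; induction n as [|n IH]; cbn; now rewrite ?IH. Qed.

Lemma tag_word_tag n p : tag_word (tag n p) = p.
Proof. unfold tag_word, tag; induction n as [|n IH]; cbn; now rewrite ?IH. Qed.

Lemma tag_length n p : length (tag n p) = length p + S n.
Proof. unfold tag; rewrite length_app, repeat_length; cbn; lia. Qed.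

(** The second case is a default: a word made of [true] only has no separator, and [untag] reads it
    as if the empty word followed. *)
Lemma untag_spec w n p :
  untag w = (n, p) <-> w = tag n p \/ (p = [] /\ w = repeat true n).
Proof.
  split.
  - revert n p; induction w as [|[] w IH]; cbn; intros n p H; inversion H; subst.
    + now right.
    + destruct (untag w) as [m q]; cbn; destruct (IH m q eq_refl) as [->|[-> ->]];
        [now left | now right].
    + now left.
  - intros [->|[-> ->]].
    + rewrite (surjective_pairing (untag _)).
      now rewrite (tag_index_tag n p : fst _ = _), (tag_word_tag n p : snd _ = _).
    + induction n as [|n IH]; cbn; now rewrite ?IH.
Qed.

Lemma rec_num_repeat_app A f g : Rec A f -> Rec A g ->
  Rec A (fun x => num (repeat true (f x) ++ to_word (g x))).
Proof.
  intros Hf Hg.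
  apply rec_ext with (fun x => nat_rect (fun _ => nat) (g x) (fun _ r => S (S (r + r))) (f x)).
  - intros x; induction (f x) as [|n IH]; cbn [repeat app nat_rect].
    + now rewrite num_to_word.
    + now rewrite num_true, IH.
  - rec.
Qed.

Lemma rec_tag A f g : Rec A f -> Rec A g ->
  Rec A (fun x => num (tag (f x) (to_word (g x)))).
Proof.
  intros Hf Hg.
  apply rec_ext with (fun x => num (repeat true (f x) ++ to_word (S (g x + g x)))).
  - intros x; unfold tag; do 2 f_equal.
    apply num_word_inj; now rewrite num_to_word, num_false, num_to_word.
  - apply rec_num_repeat_app; rec.
Qed.

(** The graph is a disjunction of decidable equations between recursive functions, so decoding is
    obtained by search through [rec_graph]. *)
Lemma rec_untag A :
  Rec A (fun m => <<tag_index (to_word m), num (tag_word (to_word m))>>).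
Proof.
  apply rec_graph.
  apply sig_ext with (fun z => num (to_word (pi1 z)) = num (tag (pi1 (pi2 z)) (to_word (pi2 (pi2 z)))) \/
    (pi2 (pi2 z) = 0 /\
     num (to_word (pi1 z)) = num (repeat true (pi1 (pi2 z)) ++ to_word 0))).
  - intros z; pose proof (untag_spec (to_word (pi1 z)) (pi1 (pi2 z)) (to_word (pi2 (pi2 z)))) as H.
    assert (E : to_word 0 = []) by (apply num_word_inj; now rewrite num_to_word).
    rewrite E, app_nil_r; split.
    + intros H'; rewrite <- (pair_pi (pi2 z)); unfold tag_index, tag_word.
      rewrite (proj2 H); [cbn; now rewrite num_to_word|].
      destruct H' as [H'|[Hz H']]; apply num_word_inj in H'; [now left|].
      right; now rewrite Hz.
    + intros Hz.
      destruct (proj1 H) as [->|[Hp ->]]; [|now left|].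
      * rewrite Hz, pi1_pair, pi2_pair, to_word_num; apply surjective_pairing.
      * right; split; [|reflexivity].
        rewrite <- (num_to_word (pi2 (pi2 z))), Hp; reflexivity.
  - apply sig_or; [|apply sig_and]; apply sig_dec, dec_eq.
    + apply rec_ext with pi1; [intros; now rewrite num_to_word | rec].
    + apply rec_tag; rec.
    + rec.
    + rec.
    + apply rec_ext with pi1; [intros; now rewrite num_to_word | rec].
    + apply rec_num_repeat_app; rec.
Qed.

Lemma rec_tag_index A f : Rec A f -> Rec A (fun x => tag_index (to_word (f x))).
Proof.
  intros Hf; pose proof (rec_pi1 (rec_app (rec_untag A) Hf)) as H; revert H.
  apply rec_ext; intros x; now autorewrite with pi.
Qed.

Lemma rec_tag_word A f : Rec A f -> Rec A (fun x => num (tag_word (to_word (f x)))).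
Proof.
  intros Hf; pose proof (rec_pi2 (rec_app (rec_untag A) Hf)) as H; revert H.
  apply rec_ext; intros x; now autorewrite with pi.
Qed.
(** * Self-enumerated systems *)

Lemma option_ext X (a b : option X) : (forall v, a = Some v <-> b = Some v) -> a = b.
Proof.
  intros H; destruct a as [v|]; [symmetry; now apply H|].
  destruct b as [v|]; [now apply H | reflexivity].
Qed.

Lemma partial_function X Y (P : X -> Y -> Prop) :
  exists f : X -> option Y, forall x,
    (forall v v', P x v -> P x v' -> v = v') -> forall v, f x = Some v <-> P x v.
Proof.
  exists (fun x => match excluded_middle_informative (exists v, P x v) with
    | left H => Some (proj1_sig (constructive_indefinite_description _ H))
    | right _ => None end).
  intros x Hx v; destruct excluded_middle_informative as [H|H].
  - destruct constructive_indefinite_description as [w Hw]; cbn; split.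
    + now intros [= <-].
    + intros Hv; f_equal; eauto.
  - split; [discriminate | intros Hv; exfalso; eauto].
Qed.

Definition self_enumerated D (F : family D) : Prop :=
  (forall G phi, F G -> total_recursive phi -> F (fun p => G (phi p))) /\
  (exists U, F U /\ forall G, F G -> exists n, forall p, G p = U (tag n p)) /\
  (forall x, exists G p, F G /\ G p = Some x).

(** Epsilon has the required property once some complexity function is exhibited: tagging provides a
    good universal function, and minimal lengths exist because every [x] is a value of it. *)
Lemma complexity_spec D (F : family D) :
  self_enumerated F -> is_complexity F (complexity F).
Proof.
  intros (_ & (U & HU & Huniv) & Honto); unfold complexity; apply epsilon_spec.
  assert (Hmin : forall x, exists k, (exists p, U p = Some x /\ length p = k) /\
    forall p, U p = Some x -> k <= length p).
  { intros x; destruct (Honto x) as (G & p & HG & Hp), (Huniv G HG) as [n Hn].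
    rewrite Hn in Hp.
    destruct (dec_inh_nat_subset_has_unique_least_element
      (fun k => exists p, U p = Some x /\ length p = k)) as (k & [Hk Hle] & _).
    - intros k; apply classic.
    - eauto.
    - exists k; split; [exact Hk|]; intros q Hq; apply Hle; eauto. }
  exists (fun x => proj1_sig (constructive_indefinite_description _ (Hmin x))), U; split.
  - split; [exact HU|]; exists (fun e p => tag (num e) p); split; [|split].
    + refine (partial_recursive_of_sig _ _ _
        (fun m r => r = num (tag (pi1 m) (to_word (pi2 m)))) _ _).
      * apply sig_dec, dec_eq; [rec | apply rec_tag; rec].
      * intros [e p] n; change (num (e, p)) with <<num e, num p>>; cbn [fst snd].
        rewrite pi1_pair, pi2_pair, to_word_num; split; [eauto|].
        intros (w & [= <-] & ->); reflexivity.
    + intros G HG; destruct (Huniv G HG) as [n Hn]; exists (to_word n).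
      now rewrite num_to_word.
    + intros e; exists (S (num e)); intros p; now rewrite tag_length.
  - intros x; destruct constructive_indefinite_description as [k Hk]; exact Hk.
Qed.

Lemma complexity_upper D (F : family D) G : self_enumerated F -> F G ->
  exists c, forall p x, G p = Some x -> complexity F x <= length p + c.
Proof.
  intros HF HG; destruct (complexity_spec HF) as (U & (_ & comp & _ & Huniv & Hlen) & Hk).
  destruct (Huniv G HG) as [e He], (Hlen e) as [c Hc]; exists c; intros p x Hp.
  rewrite He in Hp; apply (proj2 (Hk x)) in Hp; specialize (Hc p); lia.
Qed.

Lemma complexity_le D1 D2 (F1 : family D1) (F2 : family D2) i1 i2 d :
  self_enumerated F1 -> self_enumerated F2 ->
  (forall U, F2 U -> exists G, F1 G /\
     forall p x, d <= x -> U p = Some (i2 x) -> G p = Some (i1 x)) ->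
  ct_le (fun x : nat => complexity F1 (i1 x)) (fun x : nat => complexity F2 (i2 x)).
Proof.
  intros H1 H2 H; destruct (complexity_spec H2) as (U & [HU _] & Hk).
  destruct (H U HU) as (G & HG & HUG), (complexity_upper G H1 HG) as [c Hc].
  assert (Hd : exists e, forall x, x < d -> complexity F1 (i1 x) <= e).
  { clear; induction d as [|d [e He]]; [exists 0; lia|].
    exists (e + complexity F1 (i1 d)); intros x Hx.
    destruct (Nat.eq_dec x d) as [->|]; [lia|].
    assert (complexity F1 (i1 x) <= e) by (apply He; lia); lia. }
  destruct Hd as [e He]; exists (c + e); intros x.
  destruct (Nat.lt_ge_cases x d) as [Hx|Hx]; [specialize (He x Hx); lia|].
  destruct (proj1 (Hk (i2 x))) as (p & Hp & <-).
  apply HUG, Hc in Hp; [lia | exact Hx].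
Qed.

Lemma ct_eq_sym D (f g : D -> nat) : f =ct g -> g =ct f.
Proof. now intros [H H']. Qed.

Lemma ct_eq_trans D (f g h : D -> nat) : f =ct g -> g =ct h -> f =ct h.
Proof.
  assert (T : forall f g h : D -> nat, ct_le f g -> ct_le g h -> ct_le f h).
  { intros f' g' h' [c Hc] [e He]; exists (c + e); intros x.
    specialize (Hc x); specialize (He x); lia. }
  intros [H1 H2] [H3 H4]; split; eapply T; eassumption.
Qed.

Lemma PR_uniformize A (R : word -> nat -> Prop) :
  Sig A (fun z => R (to_word (pi1 z)) (pi2 z)) ->
  exists G, PR A G /\ forall p,
    (forall y, G p = Some y -> R p y) /\ ((exists y, R p y) -> exists y, G p = Some y).
Proof.
  intros HR; destruct (uniformize (fun m y => R (to_word m) y) HR) as [c Hc].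
  destruct (partial_function (fun (p : word) y => eval A c (num p) y)) as [G HG].
  assert (HG' : forall (p : word) y, G p = Some y <-> eval A c (num p) y).
  { intros p; apply HG; intros y y'; apply eval_det. }
  exists G; split.
  - apply partial_recursive_word.
    apply sig_ext with (fun z => eval A c (pi1 z) (pi2 z)).
    + intros z; now rewrite HG', num_to_word.
    + apply sig_eval; rec.
  - intros p; destruct (Hc (num p)) as [H1 H2]; rewrite to_word_num in *; split.
    + intros y Hy; now apply H1, HG'.
    + intros Hy; destruct (H2 Hy) as [y' Hy']; exists y'; now apply HG'.
Qed.

Lemma self_enumerated_PR A : self_enumerated (PR A).
Proof.
  split; [|split].
  - intros G phi HG Hphi; unfold PR in *; rewrite partial_recursive_word in *.
    apply total_recursive_word, (rec_emptyset A) in Hphi.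
    apply sig_ext with (fun z => G (to_word (num (phi (to_word (pi1 z))))) = Some (pi2 z)).
    + intros z; now rewrite to_word_num.
    + apply (sig_app2 (fun m y => G (to_word m) = Some y)
        (f := fun z => num (phi (to_word (pi1 z))))); [exact HG | | rec].
      apply (rec_app Hphi); rec.
  - destruct (@PR_uniformize A (fun w y => universal A (tag_index w) (num (tag_word w)) y))
      as (U & HU & Hspec).
    { apply sig_universal; [apply rec_tag_index; rec | apply rec_tag_word; rec | rec]. }
    exists U; split; [exact HU|].
    intros G [c Hc]; exists (code_num c); intros p; apply option_ext; intros y.
    destruct (Hspec (tag (code_num c) p)) as [H1 H2].
    rewrite tag_index_tag, tag_word_tag in *.
    assert (E : universal A (code_num c) (num p) y <-> G p = Some y).
    { rewrite universal_code, Hc; split; [intros (y' & Hy & ->); exact Hy | now exists y]. }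
    rewrite <- E; split.
    + intros Hy; destruct H2 as [y' Hy']; [eauto|].
      now rewrite (universal_det Hy (H1 _ Hy')).
    + apply H1.
  - intros n; exists (fun _ => Some n), []; split; [|reflexivity].
    apply partial_recursive_word, sig_ext with (fun z => pi2 z = n); [|rec].
    intros z; split; [now intros -> | now intros [= ->]].
Qed.

(** The functions [p |-> v] with [P (R p) v], where [R] is a uniformly [A]-r.e.
    family of sets. *)
Definition uniform_family A D (P : (nat -> Prop) -> D -> Prop) : family D := fun G =>
  exists R : word -> nat -> Prop, Sig A (fun z => R (to_word (pi1 z)) (pi2 z)) /\
    defined_by G (fun p => P (R p)).

(** Universality is inherited from the sets: they are enumerated uniformly, and [P] is applied
    afterwards. *)
Lemma self_enumerated_uniform A D (P : (nat -> Prop) -> D -> Prop) :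
  (forall S v v', P S v -> P S v' -> v = v') ->
  (forall v, exists S, Sig A S /\ P S v) ->
  self_enumerated (uniform_family A P).
Proof.
  intros Hdet Honto; split; [|split].
  - intros G phi (R & HR & HG) Hphi; exists (fun p => R (phi p)); split.
    + apply total_recursive_word, (rec_emptyset A) in Hphi.
      apply sig_ext with (fun z => R (to_word (num (phi (to_word (pi1 z))))) (pi2 z)).
      * intros z; now rewrite to_word_num.
      * apply (sig_app2 (fun m y => R (to_word m) y)
          (f := fun z => num (phi (to_word (pi1 z))))); [exact HR | | rec].
        apply (rec_app Hphi); rec.
    + intros p v; apply HG.
  (* The tag selects a program, and its domain on pairs of parameter and element is the enumerated
     family. *)
  - set (R := fun w x => exists y, universal A (tag_index w) <<num (tag_word w), x>> y).
    destruct (partial_function (fun p => P (R p))) as [U HU].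
    assert (HU' : defined_by U (fun p => P (R p))) by (intros p; apply HU; eauto).
    exists U; split.
    + exists R; split; [|exact HU']; apply sig_ex, sig_universal;
        [apply rec_tag_index; rec | apply rec_pair; [apply rec_tag_word|]; rec | rec].
    + intros G (T & HT & HG).
      destruct (@uniformize A (fun z _ => T (to_word (pi1 z)) (pi2 z))) as [c Hc].
      { apply (sig_app HT); rec. }
      exists (code_num c); intros p; apply option_ext; intros v.
      rewrite (HG p v), (HU' _ v).
      enough (E : T p = R (tag (code_num c) p)) by (now rewrite E).
      extensionality x; apply propositional_extensionality; unfold R.
      rewrite tag_index_tag, tag_word_tag.
      destruct (Hc <<num p, x>>) as [H1 H2]; rewrite pi1_pair, pi2_pair, to_word_num in *.
      split.
      * intros H; destruct H2 as [y Hy]; [now exists 0|].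
        exists y; now apply universal_code.
      * intros [y Hy]; now apply (H1 y), universal_code.
  - intros v; destruct (Honto v) as (S & HS & Hv).
    destruct (partial_function (fun _ : word => P S)) as [G HG].
    assert (HG' : defined_by G (fun _ => P S)) by (intros p; apply HG; eauto).
    exists G, []; split; [|now apply HG']; exists (fun _ => S); split; [|exact HG'].
    apply (sig_app HS); rec.
Qed.

Lemma family_ext D (F F' : family D) : (forall G, F G <-> F' G) -> F = F'.
Proof.
  intros H; extensionality G; now apply propositional_extensionality.
Qed.

(** A maximum depends only on the set of values, and this set is r.e. in [A] uniformly in [p]. *)
Lemma MaxPR_uniform A :
  MaxPR A = uniform_family A (fun S m => S m /\ forall v, S v -> v <= m).
Proof.
  apply family_ext; intros G; split.
  - intros (f & Hf & HG).
    destruct (sig_of_partial_recursive Hf) as (N & HN & E).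
    assert (E' : forall (p : word) t v, f (p, t) = Some v <-> N <<num p, t>> v).
    { intros p t v; change <<num p, t>> with (num (p, t)); rewrite E; split.
      - intros H; now exists v.
      - intros (y & Hy & ->); exact Hy. }
    exists (fun p v => exists t, f (p, t) = Some v); split.
    + apply sig_ext with (fun z => exists t, N <<pi1 z, t>> (pi2 z)).
      * intros z; split; intros [t Ht]; exists t; [apply E' | apply E' in Ht];
          now rewrite num_to_word in *.
      * rec; apply (sig_app2 N); [exact HN | rec | rec].
    + intros p m; rewrite (HG p m); unfold is_max; firstorder.
  - intros (R & (D & HD & HR) & HG).
    assert (HR' : forall p v, R p v <-> exists k, D <<<<num p, v>>, k>>).
    { intros p v; specialize (HR <<num p, v>>).
      now rewrite pi1_pair, pi2_pair, to_word_num in HR. }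
    (* The argument [t] codes a candidate value with a witness; the candidate is returned when the
       witness is correct. *)
    destruct (partial_function (fun (pt : word * nat) v =>
      D <<<<num (fst pt), pi1 (snd pt)>>, pi2 (snd pt)>> /\ v = pi1 (snd pt))) as [f Hf].
    assert (Hf' : forall p t v, f (p, t) = Some v <->
      D <<<<num p, pi1 t>>, pi2 t>> /\ v = pi1 t).
    { intros p t; apply (Hf (p, t)); intros v v' [_ ->] [_ ->]; reflexivity. }
    exists f; split.
    + refine (partial_recursive_of_sig _ _ _ (fun m v =>
        D <<<<pi1 m, pi1 (pi2 m)>>, pi2 (pi2 m)>> /\ v = pi1 (pi2 m)) _ _).
      * apply sig_dec; rec.
      * intros [p t] n; change (num (p, t)) with <<num p, t>>; rewrite pi1_pair, pi2_pair.
        rewrite <- Hf'; split; [now exists n | intros (y & Hy & ->); exact Hy].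
    + assert (E : forall p v, R p v <-> exists t, f (p, t) = Some v).
      { intros p v; rewrite HR'; split.
        - intros [k Hk]; exists <<v, k>>; apply Hf'; now rewrite pi1_pair, pi2_pair.
        - intros [t Ht]; apply Hf' in Ht as [Ht ->]; eauto. }
      intros p m; rewrite (HG p m); unfold is_max; rewrite E.
      split; intros [H H']; (split; [exact H|]).
      * intros t v Ht; apply H', E; eauto.
      * intros v Hv; apply E in Hv as [t Ht]; eauto.
Qed.

Lemma self_enumerated_MaxPR A : self_enumerated (MaxPR A).
Proof.
  rewrite MaxPR_uniform; apply self_enumerated_uniform.
  - intros S v v' [H1 H2] [H3 H4]; apply Nat.le_antisymm; auto.
  - intros v; exists (fun x => x = v); split; [rec|]; split; [reflexivity | now intros x ->].
Qed.

(** * Differences *)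

Lemma self_enumerated_Delta (F : family nat) :
  self_enumerated F -> self_enumerated (Delta F).
Proof.
  intros (Hcomp & (U & HU & Huniv) & Honto); split; [|split].
  - intros G phi (F1 & F2 & H1 & H2 & HG) Hphi.
    exists (fun p => F1 (phi p)), (fun p => F2 (phi p)); auto.
  - assert (Hphi : forall pi, Rec emptyset pi ->
      total_recursive (fun w => tag (pi (tag_index w)) (tag_word w))).
    { intros pi Hpi; apply total_recursive_word.
      apply rec_ext with (fun n => num (tag (pi (tag_index (to_word n)))
        (to_word (num (tag_word (to_word n)))))).
      - intros n; now rewrite to_word_num.
      - apply rec_tag; [apply (rec_app Hpi), rec_tag_index; rec | apply rec_tag_word; rec]. }
    (* The tag of a difference codes the two tags of its terms, which are then run on the same
       word. *)
    exists (fun w => match U (tag (pi1 (tag_index w)) (tag_word w)),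
                           U (tag (pi2 (tag_index w)) (tag_word w)) with
                     | Some a, Some b => Some (Z.of_nat a - Z.of_nat b)%Z
                     | _, _ => None
                     end); split.
    + exists (fun w => U (tag (pi1 (tag_index w)) (tag_word w))),
        (fun w => U (tag (pi2 (tag_index w)) (tag_word w))); split; [|split; [|reflexivity]].
      * apply (Hcomp U (fun w => tag (pi1 (tag_index w)) (tag_word w)) HU), Hphi; rec.
      * apply (Hcomp U (fun w => tag (pi2 (tag_index w)) (tag_word w)) HU), Hphi; rec.
    + intros G (F1 & F2 & H1 & H2 & HG).
      destruct (Huniv F1 H1) as [n1 E1], (Huniv F2 H2) as [n2 E2].
      exists <<n1, n2>>; intros p; rewrite HG, E1, E2, tag_index_tag, tag_word_tag.
      now rewrite pi1_pair, pi2_pair.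
  - intros z; destruct (Honto (Z.to_nat z)) as (F1 & p1 & H1 & E1).
    destruct (Honto (Z.to_nat (- z))) as (F2 & p2 & H2 & E2).
    assert (Hconst : forall p : word, total_recursive (fun _ : word => p))
      by (intros p; apply total_recursive_word; rec).
    exists (fun _ => Some z), []; split; [|reflexivity].
    exists (fun _ => F1 p1), (fun _ => F2 p2); split; [|split].
    + now apply (Hcomp F1 (fun _ => p1)).
    + now apply (Hcomp F2 (fun _ => p2)).
    + intros _; rewrite E1, E2; f_equal; lia.
Qed.

Lemma Delta_extension A (F : family nat) :
  (forall G, F G -> exists G', PR A G' /\ forall p n, G p = Some n -> G' p = Some n) ->
  forall G, Delta F G ->
    exists G', PR A G' /\ forall p n, G p = Some (Z.of_nat n) -> G' p = Some n.
Proof.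
  intros HF G (F1 & F2 & H1 & H2 & HG).
  destruct (HF F1 H1) as (G1 & HG1 & E1), (HF F2 H2) as (G2 & HG2 & E2).
  destruct (@PR_uniformize A (fun p n => exists a b, G1 p = Some a /\ G2 p = Some b /\ a = n + b))
    as (G' & HG' & Hspec).
  { unfold PR in HG1, HG2; rewrite partial_recursive_word in HG1, HG2.
    apply sig_ex, sig_ex, sig_and; [|apply sig_and; [|rec]].
    - apply (sig_app2 (fun m y => G1 (to_word m) = Some y)); [exact HG1 | rec | rec].
    - apply (sig_app2 (fun m y => G2 (to_word m) = Some y)); [exact HG2 | rec | rec]. }
  exists G'; split; [exact HG'|]; intros p n Hn; rewrite HG in Hn.
  destruct (F1 p) as [a|] eqn:Ea; [|discriminate].
  destruct (F2 p) as [b|] eqn:Eb; [|discriminate].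
  apply E1 in Ea; apply E2 in Eb; injection Hn as Hn.
  destruct (Hspec p) as [S1 S2]; destruct S2 as [n' Hn'].
  - exists n, a, b; repeat split; trivial; lia.
  - rewrite Hn'; destruct (S1 _ Hn') as (a' & b' & Ha & Hb & ->).
    rewrite Ha in Ea; rewrite Hb in Eb; f_equal; injection Ea as Ea; injection Eb as Eb; lia.
Qed.
(** * Counting the elements of uniformly enumerable sets *)

(** [F] computes, up to the shift [d], the cardinals of the [B]-r.e. sets, and
    its values are approximated from below by [B]-r.e. predicates. *)
Record counting (B : nat -> Prop) (F : family nat) (d : nat) : Prop := {
  counting_enumerated : self_enumerated F;
  counting_card : forall S : word -> nat -> Prop,
    Sig B (fun z => S (to_word (pi1 z)) (pi2 z)) ->
    exists G, F G /\ forall p m, has_card (S p) m -> G p = Some (m + d);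
  counting_below : forall G, F G -> exists S : word -> nat -> Prop,
    Sig B (fun z => S (to_word (pi1 z)) (pi2 z)) /\
    forall p n, G p = Some n -> forall k, S p k <-> k <= n
}.

Lemma has_card_lt (S : nat -> Prop) n : (forall x, S x <-> x < n) -> has_card S n.
Proof.
  intros H; exists (seq 0 n); split; [apply seq_NoDup|]; split; [|apply length_seq].
  intros x; rewrite H, in_seq; lia.
Qed.

Lemma counting_MaxPR B F d : counting B F d -> complexity F =ct Kmax_oracle B.
Proof.
  intros [HF Hcard Hbelow]; pose proof (self_enumerated_MaxPR B) as HM; split.
  - apply (complexity_le (fun x => x) (fun x => x) (d := d) HF HM).
    rewrite MaxPR_uniform; intros U (R & HR & HU).
    (* If the maximum is [m], exactly [m - d] numbers [n] satisfy [n + d < v] for some value [v],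
       and the shift in [counting_card] restores [m]. This needs [d <= m], the threshold passed to
       [complexity_le]. *)
    destruct (Hcard (fun p n => exists v, R p v /\ n + d < v)) as (G & HG & Hspec).
    { rec; apply (sig_app2 (fun m v => R (to_word m) v)); [exact HR | rec | rec]. }
    exists G; split; [exact HG|]; intros p m Hd Hm; apply HU in Hm as [Hm Hle].
    rewrite (Hspec p (m - d)); [f_equal; lia|].
    apply has_card_lt; intros x; split.
    + intros (v & Hv & Hx); apply Hle in Hv; lia.
    + intros Hx; exists m; split; [exact Hm | lia].
  - apply (complexity_le (fun x => x) (fun x => x) (d := 0) HM HF).
    intros U HU; destruct (Hbelow U HU) as (S & HS & Hspec).
    destruct (partial_function (fun p m => S p m /\ forall v, S p v -> v <= m)) as [G HG].
    assert (HG' : defined_by G (fun p m => S p m /\ forall v, S p v -> v <= m)).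
    { intros p; apply HG; intros v v' [H1 H2] [H3 H4]; apply Nat.le_antisymm; auto. }
    exists G; split; [rewrite MaxPR_uniform; exists S; now split|].
    intros p n _ Hn; apply HG'; split; [now apply (Hspec p n Hn)|].
    intros v; apply (Hspec p n Hn).
Qed.

Definition psum (v : nat) : nat := nat_rect (fun _ => nat) 0 (fun i r => r + pi1 i) v.

Lemma rec_psum A f : Rec A f -> Rec A (fun x => psum (f x)).
Proof. intros Hf; unfold psum; rec. Qed.

Lemma psum_mono v w : v <= w -> psum v <= psum w.
Proof. induction 1; [lia|]; unfold psum in *; cbn; lia. Qed.

(** A function partial recursive in [jump B] is [p |-> pi1 v] for the least [v]
    never refuted by a [B]-r.e. relation; as [pi1 v = psum (S v) - psum v] and
    [psum] is increasing, it is the difference of the cardinals of two [B]-r.e.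
    initial segments of [nat]. *)
Lemma counting_Delta B F d : counting B F d ->
  restrict_nat (complexity (Delta F)) =ct K_oracle (jump B).
Proof.
  intros [HF Hcard Hbelow].
  pose proof (self_enumerated_PR (jump B)) as HP; apply self_enumerated_Delta in HF as HD; split.
  - apply (complexity_le Z.of_nat (fun x => x) (d := 0) HD HP); intros U HU.
    apply partial_recursive_word, sig_jump_sig2 in HU as (R & HR & HU).
    assert (HU' : forall p y, U p = Some y <-> exists k, ~ R <<num p, y>> k).
    { intros p y; rewrite <- HU; now rewrite pi1_pair, pi2_pair, to_word_num. }
    (* The [v] that satisfy the second condition are those up to the least unrefuted one. For
       increasing [f] the segment is thus the set of numbers below [f] of that least [v]. *)
    set (segment := fun f (p : word) n => exists v : nat, n < f v /\
      forall w, w < v -> R <<num p, pi1 w>> (pi2 w)).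
    assert (Hseg : forall f, Rec B f ->
      Sig B (fun z => segment f (to_word (pi1 z)) (pi2 z))).
    { intros f Hf; unfold segment; apply sig_ext with (fun z => exists v, pi2 z < f v /\
        forall w, w < v -> R <<pi1 z, pi1 w>> (pi2 w)).
      - intros z; now rewrite num_to_word.
      - rec; apply (sig_app2 R); [exact HR | rec | rec]. }
    assert (Hpsum : Rec B psum) by (apply rec_psum; rec).
    destruct (Hcard _ (Hseg (fun v => psum (S v)) (rec_psum (rec_S (rec_id B))))) as (G1 & HG1 & S1).
    destruct (Hcard _ (Hseg psum Hpsum)) as (G2 & HG2 & S2).
    exists (fun p => match G1 p, G2 p with
                     | Some a, Some b => Some (Z.of_nat a - Z.of_nat b)%Z
                     | _, _ => None
                     end); split; [exists G1, G2; now split|].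
    intros p y _ Hy.
    destruct (dec_inh_nat_subset_has_unique_least_element
      (fun v => ~ R <<num p, pi1 v>> (pi2 v))) as (v & [Hv Hmin] & _).
    { intros v; apply classic. }
    { apply HU' in Hy as [k Hk]; exists <<y, k>>; now rewrite pi1_pair, pi2_pair. }
    assert (Hlt : forall f, (forall v w, v <= w -> f v <= f w) ->
      has_card (segment f p) (f v)).
    { intros f Hf; apply has_card_lt; intros n; split.
      - intros (w & Hn & Hw); enough (f w <= f v) by lia.
        apply Hf; destruct (Nat.le_gt_cases w v); [assumption|]; exfalso; auto.
      - intros Hn; exists v; split; [exact Hn|]; intros w Hw; apply NNPP; intros H.
        apply Hmin in H; lia. }
    (* The shift [d] occurs in both terms of the difference and cancels. *)
    rewrite (S1 p (psum (S v))), (S2 p (psum v)).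
    + assert (U p = Some (pi1 v)) by (apply HU'; eauto).
      f_equal; replace y with (pi1 v) by congruence.
      unfold psum; cbn [nat_rect]; lia.
    + apply (Hlt psum), psum_mono.
    + apply (Hlt (fun v => psum (S v))); intros; apply psum_mono; lia.
  - apply (complexity_le (fun x => x) Z.of_nat (d := 0) HP HD); intros U HU.
    destruct (@Delta_extension (jump B) F) with (G := U) as (G & HG & E); [|exact HU|].
    + intros G HG; destruct (Hbelow G HG) as (S & HS & Hspec).
      (* Where the value [n] is defined, [S p] is the set of numbers up to [n], and [n] is its only
         member whose successor is outside. The jump decides both memberships. *)
      destruct (@PR_uniformize (jump B) (fun p n => S p n /\ ~ S p (Datatypes.S n)))
        as (G' & HG' & E).
      { apply dec_jump in HS; apply sig_dec, dec_and; [exact HS|].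
        apply dec_not, (dec_app2 (fun m x => S (to_word m) x)); trivial; rec. }
      exists G'; split; [exact HG'|]; intros p n Hn; destruct (E p) as [E1 E2].
      specialize (Hspec p n Hn); destruct E2 as [y Hy].
      * exists n; rewrite !Hspec; lia.
      * rewrite Hy; apply E1 in Hy; rewrite !Hspec in Hy; f_equal; lia.
    + exists G; split; [exact HG|]; intros p x _; apply E.
Qed.

(** * Cardinals *)

Lemma has_card_unique T (Y : T -> Prop) n n' : has_card Y n -> has_card Y n' -> n = n'.
Proof.
  intros (l & Hl & HY & <-) (l' & Hl' & HY' & <-).
  apply Nat.le_antisymm; apply NoDup_incl_length; trivial; intros x Hx.
  - now apply HY', HY.
  - now apply HY, HY'.
Qed.

(** Pigeonhole in one direction, a choice of preimages in the other. The map [h] is the identity for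
    cardinals and sends an element to its class for indices. *)
Lemma has_card_below T (h : nat -> T) (Y : nat -> Prop) n :
  has_card (fun C => exists x, Y x /\ C = h x) n -> forall k,
  (exists L, forall i, i < k ->
     Y (seqn L i) /\ forall j, j < i -> h (seqn L j) <> h (seqn L i)) <-> k <= n.
Proof.
  intros (l & Hl & HY & <-) k; split.
  - intros [L HL].
    rewrite <- (length_seq k 0), <- (length_map (fun i => h (seqn L i))).
    apply NoDup_incl_length.
    + clear HY; induction k as [|k IH]; [constructor|].
      rewrite seq_S, map_app; cbn; apply NoDup_Add with (a := h (seqn L k))
        (l := map (fun i => h (seqn L i)) (seq 0 k)).
      * rewrite <- (app_nil_r (map _ _)) at 1; apply Add_app.
      * split; [apply IH; intros i Hi; apply HL; lia|].
        rewrite in_map_iff; intros (i & Hi & Hin); apply in_seq in Hin.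
        apply (HL k) with i; [lia | lia | exact Hi].
    + intros C HC; apply in_map_iff in HC as (i & <- & Hi); apply in_seq in Hi.
      apply HY; exists (seqn L i); split; [apply HL; lia | reflexivity].
  - intros Hk.
    destruct (seqn_choice (fun i x => Y x /\ nth_error l i = Some (h x)) (n := k)) as [L HL].
    + intros i Hi; destruct (nth_error l i) as [C|] eqn:E.
      * destruct (proj1 (HY C) (nth_error_In _ _ E)) as (x & Hx & ->); eauto.
      * apply nth_error_None in E; lia.
    + exists L; intros i Hi; destruct (HL i Hi) as [H1 H2]; split; [exact H1|].
      intros j Hj E; destruct (HL j) as [_ H3]; [lia|].
      assert (j = i); [|lia].
      apply (proj1 (NoDup_nth_error l) Hl); [lia | congruence].
Qed.

(** This removes the dependence on the chosen enumeration: recursiveness of the enumerating function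
    makes the sets uniformly r.e., and the s-m-n property turns a uniform family back into a
    recursive choice of indices. *)
Lemma family_of_acceptable X (nX : Numbering X) (W : word -> X -> Prop) D
  (Q : (X -> Prop) -> D -> Prop) : acceptable W ->
  (fun G => exists phi, total_recursive phi /\ defined_by G (fun p => Q (W (phi p)))) =
  uniform_family emptyset (fun S => Q (fun x => S (num x))).
Proof.
  intros (f & (Hf & _ & Hsmn) & HW); apply family_ext; intros G; split.
  - intros (phi & Hphi & HG); destruct (sig_of_partial_recursive Hf) as (N & HN & E).
    exists (fun p n => exists y, N <<num (phi p), n>> y); split.
    + apply total_recursive_word in Hphi; apply sig_ex.
      apply (sig_app2 N (f := fun z => <<num (phi (to_word (pi1 (pi1 z)))), pi2 (pi1 z)>>));
        [exact HN | | rec].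
      apply rec_pair; [apply (rec_app Hphi)|]; rec.
    + intros p v; rewrite (HG p v).
      enough (E' : W (phi p) = (fun x => exists y, N <<num (phi p), num x>> y))
        by (now rewrite E').
      extensionality x; apply propositional_extensionality; rewrite HW.
      change <<num (phi p), num x>> with (num (phi p, x)).
      split; intros [y Hy]; [exists y; apply E; now exists y|].
      apply E in Hy as (y' & Hy & _); now exists y'.
  - intros (R & HR & HG).
    destruct (partial_function (fun (px : word * X) y => R (fst px) (num (snd px)) /\ y = 0))
      as [psi Hpsi].
    assert (Hpsi' : forall p x y, psi (p, x) = Some y <-> R p (num x) /\ y = 0).
    { intros p x; apply (Hpsi (p, x)); intros v v' [_ ->] [_ ->]; reflexivity. }
    destruct (Hsmn psi) as (s & Hs & E).
    { refine (partial_recursive_of_sig _ _ _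
        (fun m y => R (to_word (pi1 m)) (pi2 m) /\ y = 0) _ _).
      - rec; apply (sig_app HR); rec.
      - intros [p x] n; change (num (p, x)) with <<num p, num x>>.
        rewrite pi1_pair, pi2_pair, to_word_num, <- Hpsi'.
        split; [now exists n | intros (y & Hy & ->); exact Hy]. }
    exists s; split; [exact Hs|]; intros p v; rewrite (HG p v).
    enough (E' : W (s p) = (fun x => R p (num x))) by (now rewrite E').
    extensionality x; apply propositional_extensionality; rewrite HW; split.
    + intros [y Hy]; rewrite E in Hy; now apply Hpsi' in Hy.
    + intros H; exists 0; rewrite E; now apply Hpsi'.
Qed.

Lemma counting_Card W : acceptable W -> counting emptyset (Card W) 0.
Proof.
  intros HW; pose proof (family_of_acceptable (@has_card nat) HW : Card W = _) as ->; split.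
  - apply self_enumerated_uniform.
    + intros S v v'; apply has_card_unique.
    + intros v; exists (fun x => x < v); split; [rec | now apply has_card_lt].
  - intros S HS; destruct (partial_function (fun p => has_card (S p))) as [G HG].
    assert (HG' : defined_by G (fun p => has_card (S p)))
      by (intros p; apply HG; intros v v'; apply has_card_unique).
    exists G; split; [now exists S|]; intros p m Hm.
    rewrite Nat.add_0_r; now apply HG'.
  - intros G (S & HS & HG).
    exists (fun p k => exists L, forall i, i < k ->
      S p (seqn L i) /\ forall j, j < i -> seqn L j <> seqn L i); split.
    + rec; apply (sig_app2 (fun m x => S (to_word m) x)); [exact HS | rec | rec].
    + intros p n Hn; apply (has_card_below (fun x => x)).
      apply HG in Hn as (l & Hl & HS' & Hlen); exists l; split; [exact Hl|].
      split; [|exact Hlen]; intros C; rewrite HS'; split; [eauto|].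
      now intros (x & Hx & ->).
Qed.

(** * Indices *)

(** The underlying set is recovered from [rho] as the set of [x] with [rho (x, x)], so uniqueness of
    cardinals is enough. *)
Lemma has_index_unique rho n n' : has_index rho n -> has_index rho n' -> n = n'.
Proof.
  intros (S & (H1 & H2 & _) & Hn) (S' & (H1' & H2' & _) & Hn').
  assert (S' = S) as -> by (extensionality x; apply propositional_extensionality; firstorder).
  eapply has_card_unique; eassumption.
Qed.

Lemma has_index_representatives (S : nat -> Prop) rho l :
  equivalence_on S rho -> NoDup l -> (forall x, In x l -> S x) ->
  (forall x y, In x l -> In y l -> rho (x, y) -> x = y) ->
  (forall x, S x -> exists y, In y l /\ rho (x, y)) ->
  has_index rho (length l).
Proof.
  intros Heq Hl HS Hdist Hall; exists S; split; [exact Heq|].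
  destruct Heq as (_ & Hrefl & Hsym & Htrans).
  exists (map (fun x y => rho (x, y)) l); split; [|split; [|apply length_map]].
  - apply NoDup_map_NoDup_ForallPairs; [|exact Hl].
    intros x y Hx Hy E; apply Hdist; trivial.
    change ((fun z => rho (x, z)) y); rewrite E; auto.
  - intros C; rewrite in_map_iff; split.
    + intros (x & <- & Hx); eauto.
    + intros (x & Hx & ->); destruct (Hall x Hx) as (y & Hy & Hxy).
      exists y; split; [|exact Hy].
      extensionality z; apply propositional_extensionality; split; eauto.
Qed.

(** A witness is made unique by asking for the least one, paired with the least
    bound on the searches refuting the smaller ones. *)
Lemma sig2_unique A P : Sig2 A P -> exists R : nat -> nat -> Prop,
  Sig A (fun z => R (pi1 z) (pi2 z)) /\
  forall x, (P x <-> exists k, ~ R x k) /\ forall k k', ~ R x k -> ~ R x k' -> k = k'.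
Proof.
  intros (R & (D & HD & HR) & HP).
  assert (HR' : forall x k, R x k <-> exists j, D <<<<x, k>>, j>>).
  { intros x k; specialize (HR <<x, k>>); now rewrite pi1_pair, pi2_pair in HR. }
  clear HR; set (below := fun x k b => forall i, i < k -> exists j, j < b /\ D <<<<x, i>>, j>>).
  (* There are three ways to refute [w]: the candidate [pi1 w] is refuted, the bound [pi2 w] does
     not suffice for the smaller candidates, or a smaller bound suffices. The last two are
     decidable. *)
  exists (fun x w => (exists j, D <<<<x, pi1 w>>, j>>) \/ ~ below x (pi1 w) (pi2 w) \/
    exists b, b < pi2 w /\ below x (pi1 w) b); split.
  { unfold below; rec; apply sig_dec; rec. }
  assert (Hdec : forall x k b, below x k b \/ ~ below x k b) by (intros; apply classic).
  intros x; split.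
  - rewrite HP; split.
    + intros Hk.
      destruct (dec_inh_nat_subset_has_unique_least_element (fun k => ~ R x k))
        as (k & [Hk' Hmin] & _); [intros k; apply classic | exact Hk|].
      assert (Hb : exists b, below x k b).
      { assert (H : forall i, i < k -> exists j, D <<<<x, i>>, j>>).
        { intros i Hi; apply HR', NNPP; intros H; apply Hmin in H; lia. }
        clear Hk' Hmin; induction k as [|k IH]; [exists 0; intros i Hi; lia|].
        destruct IH as [b Hb]; [intros i Hi; apply H; lia|].
        destruct (H k) as [j Hj]; [lia|]; exists (S (b + j)); intros i Hi.
        destruct (Nat.eq_dec i k) as [->|]; [exists j; split; [lia | exact Hj]|].
        destruct (Hb i) as (j' & Hj' & HD'); [lia|]; exists j'; split; [lia | exact HD']. }
      destruct (dec_inh_nat_subset_has_unique_least_element (below x k))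
        as (b & [Hb' Hbmin] & _); [intros b; apply Hdec | exact Hb|].
      exists <<k, b>>; rewrite pi1_pair, pi2_pair; intros [H|[H|(b' & Hlt & H)]].
      * now apply Hk', HR'.
      * now apply H.
      * apply Hbmin in H; lia.
    + intros [w Hw]; exists (pi1 w); rewrite HR'; tauto.
  - assert (Hlt : forall k k' b', (exists j, D <<<<x, k>>, j>>) \/ ~ below x k' b' \/ k' <= k).
    { intros k k' b'; destruct (Nat.le_gt_cases k' k) as [H|H]; [auto|].
      destruct (Hdec x k' b') as [Hb|Hb]; [left | auto].
      destruct (Hb k H) as (j & _ & Hj); eauto. }
    intros w w' Hw Hw'; rewrite <- (pair_pi w), <- (pair_pi w').
    assert (E : pi1 w = pi1 w').
    { pose proof (Hlt (pi1 w) (pi1 w') (pi2 w')); pose proof (Hlt (pi1 w') (pi1 w) (pi2 w)).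
      apply Nat.le_antisymm; tauto. }
    rewrite <- E in *; f_equal.
    assert (Hb : below x (pi1 w) (pi2 w)) by (apply NNPP; tauto).
    assert (Hb' : below x (pi1 w) (pi2 w')) by (apply NNPP; tauto).
    destruct (Nat.lt_trichotomy (pi2 w) (pi2 w')) as [H|[->|H]]; trivial; exfalso.
    + apply Hw'; right; right; exists (pi2 w); now split.
    + apply Hw; right; right; exists (pi2 w'); now split.
Qed.

Definition uniform_index : family nat :=
  uniform_family emptyset (fun S => has_index (fun xy : nat * nat => S (num xy))).

(** The pairs [<n, k>] with [k] a unique witness of [S p n] are kept pairwise
    inequivalent, and all the refuted pairs are merged into one more class. *)
Lemma index_of_sig2 (S : word -> nat -> Prop) :
  Sig2 emptyset (fun z => S (to_word (pi1 z)) (pi2 z)) ->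
  exists G, uniform_index G /\ forall p m, has_card (S p) m -> G p = Some (m + 1).
Proof.
  intros HS; apply sig2_unique in HS as (R & HR & HS).
  assert (HS' : forall p n, (S p n <-> exists k, ~ R <<num p, n>> k) /\
    forall k k', ~ R <<num p, n>> k -> ~ R <<num p, n>> k' -> k = k').
  { intros p n; specialize (HS <<num p, n>>).
    now rewrite pi1_pair, pi2_pair, to_word_num in HS. }
  clear HS.
  (* The successor of [<<n, k>>] stands for the pair of [n] and [k]. The point 0 is always dead, so
     the merged class is never empty and the index exceeds the cardinal by exactly 1. *)
  set (dead := fun (p : word) u => u = 0 \/ R <<num p, pi1 (pred u)>> (pi2 (pred u))).
  set (T := fun (p : word) z => pi1 z = pi2 z \/ (dead p (pi1 z) /\ dead p (pi2 z))).
  assert (HT : Sig emptyset (fun z => T (to_word (pi1 z)) (pi2 z))).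
  { unfold T, dead.
    apply sig_ext with (fun z => pi1 (pi2 z) = pi2 (pi2 z) \/
      (pi1 (pi2 z) = 0 \/ R <<pi1 z, pi1 (pred (pi1 (pi2 z)))>> (pi2 (pred (pi1 (pi2 z))))) /\
      (pi2 (pi2 z) = 0 \/ R <<pi1 z, pi1 (pred (pi2 (pi2 z)))>> (pi2 (pred (pi2 (pi2 z)))))).
    - intros z; now rewrite num_to_word.
    - rec; apply (sig_app2 R); trivial; rec. }
  destruct (partial_function (fun p => has_index (fun xy : nat * nat => T p (num xy))))
    as [G HG].
  assert (HG' : defined_by G (fun p => has_index (fun xy : nat * nat => T p (num xy))))
    by (intros p; apply HG; intros v v'; apply has_index_unique).
  exists G; split; [now exists T|]; intros p m (l & Hl & HlS & <-); apply HG'.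
  assert (HT' : (fun xy : nat * nat => T p (num xy)) =
    (fun xy => fst xy = snd xy \/ (dead p (fst xy) /\ dead p (snd xy)))).
  { extensionality xy; destruct xy as [x y]; unfold T; change (num (x, y)) with <<x, y>>.
    now rewrite pi1_pair, pi2_pair. }
  rewrite HT'.
  assert (Hw : forall n, exists k, S p n -> ~ R <<num p, n>> k).
  { intros n; destruct (classic (S p n)) as [Hn|Hn]; [|exists 0; tauto].
    destruct (HS' p n) as [E _]; apply E in Hn as [k Hk]; exists k; auto. }
  set (w := fun n => proj1_sig (constructive_indefinite_description _ (Hw n))).
  assert (Hw' : forall n, S p n -> ~ R <<num p, n>> (w n))
    by (intros n; apply (proj2_sig (constructive_indefinite_description _ (Hw n)))).
  assert (Halive : forall n, In n l -> ~ dead p (Datatypes.S <<n, w n>>)).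
  { intros n Hn [H|H]; [discriminate|]; cbn [pred] in H; rewrite pi1_pair, pi2_pair in H.
    revert H; apply Hw', HlS, Hn. }
  replace (length l + 1) with (length (0 :: map (fun n => Datatypes.S <<n, w n>>) l))
    by (cbn; rewrite length_map; lia).
  apply has_index_representatives with (fun _ => True); trivial.
  - repeat split; cbn; intros; intuition congruence.
  - constructor.
    + rewrite in_map_iff; intros (n & H & _); discriminate.
    + apply NoDup_map_NoDup_ForallPairs; [|exact Hl].
      intros n n' _ _ E; injection E as E; now apply pair_inj in E.
  - cbn; intros x y [<-|Hx] [<-|Hy] [E|[E1 E2]]; trivial.
    + now apply in_map_iff in Hy as (n & <- & Hn); apply Halive in Hn.
    + now apply in_map_iff in Hx as (n & <- & Hn); apply Halive in Hn.
    + now apply in_map_iff in Hx as (n & <- & Hn); apply Halive in Hn.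
  - cbn; intros x _; destruct (classic (dead p x)) as [Hx|Hx].
    + exists 0; split; [now left|]; right; split; [exact Hx | now left].
    + exists x; split; [right | now left]; apply in_map_iff.
      destruct x as [|x]; [destruct Hx; now left|].
      assert (Hx' : ~ R <<num p, pi1 x>> (pi2 x)) by (intros H; apply Hx; now right).
      destruct (HS' p (pi1 x)) as [E1 E2].
      assert (Hn : S p (pi1 x)) by (apply E1; eauto).
      exists (pi1 x); split; [|now apply HlS].
      rewrite (E2 (w (pi1 x)) (pi2 x)); [now rewrite pair_pi | now apply Hw' | exact Hx'].
Qed.

Lemma counting_Index W : acceptable W -> counting (jump emptyset) (Index W) 1.
Proof.
  intros HW; pose proof (family_of_acceptable has_index HW : Index W = uniform_index) as ->; split.
  - apply self_enumerated_uniform.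
    + intros S v v'; apply has_index_unique.
    + intros v; exists (fun z => pi1 z = pi2 z /\ pi1 z < v); split; [rec|].
      replace (fun xy : nat * nat => pi1 (num xy) = pi2 (num xy) /\ pi1 (num xy) < v)
        with (fun xy : nat * nat => fst xy = snd xy /\ fst xy < v).
      2: { extensionality xy; destruct xy as [x y]; change (num (x, y)) with <<x, y>>.
           now rewrite pi1_pair, pi2_pair. }
      enough (H : has_index (fun xy : nat * nat => fst xy = snd xy /\ fst xy < v)
        (length (seq 0 v))) by now rewrite length_seq in H.
      apply has_index_representatives with (fun x => x < v).
      * repeat split; cbn in *; lia.
      * apply seq_NoDup.
      * intros x Hx; apply in_seq in Hx; lia.
      * intros x y _ _ H; apply H.
      * intros x Hx; exists x; split; [apply in_seq; lia | now split].
  - intros S HS; now apply index_of_sig2, sig_jump_sig2.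
  - intros G (S & HS & HG).
    exists (fun p k => exists L, forall i, i < k ->
      S p <<seqn L i, seqn L i>> /\ forall j, j < i -> ~ S p <<seqn L j, seqn L i>>); split.
    + apply dec_jump in HS; rec; try apply sig_dec;
        apply (dec_app2 (fun m x => S (to_word m) x)); trivial; rec.
    + intros p n Hn; apply HG in Hn as (Y & Heq & Hn).
      destruct Heq as (HY & Hrefl & Hsym & Htrans).
      intros k; rewrite <- (has_card_below (fun x y => S p <<x, y>>) _ Hn k).
      split; intros [L HL]; exists L; intros i Hi; destruct (HL i Hi) as [H1 H2].
      * split; [now apply (HY (seqn L i) (seqn L i))|]; intros j Hj E; apply (H2 j Hj).
        change ((fun y => S p <<seqn L j, y>>) (seqn L i)); now rewrite E.
      * split; [now apply (Hrefl (seqn L i))|]; intros j Hj H; apply (H2 j Hj).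
        extensionality y; apply propositional_extensionality.
        specialize (Hsym (seqn L j) (seqn L i) H).
        split; intros H'; [exact (Htrans _ _ _ Hsym H') | exact (Htrans _ _ _ H H')].
Qed.
(** * Functionals *)

(** As a rule of derivation it compares an entry with all the later ones, so [closed_code ascending]
    recognizes the codes of finite functions. *)
Definition ascending (a : nat) (M : nat -> Prop) : Prop := forall b, M b -> pi1 a < pi1 b.

Lemma num_finfun_lnum (u : finfun) : num u = lnum (map (fun a => num a) (fin_list u)).
Proof.
  destruct u as [l Hl]; cbn [fin_list]; change (num (Finfun Hl)) with
    ((fix go (l : list (nat * nat)) : nat :=
       match l with [] => 0 | a :: l' => S <<num a, go l'>> end) l).
  clear Hl; induction l as [|a l IH]; [reflexivity|]; cbn [map lnum]; now rewrite <- IH.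
Qed.

Lemma fin_graph_mem u a b : fin_graph u a b <-> mem <<a, b>> (num u).
Proof.
  rewrite num_finfun_lnum, mem_lnum, in_map_iff; split.
  - intros H; now exists (a, b).
  - intros ([a' b'] & E & H); change (num (a', b')) with <<a', b'>> in E.
    now apply pair_inj in E as [-> ->].
Qed.

Lemma closed_code_finfun n : closed_code ascending n <-> exists u : finfun, num u = n.
Proof.
  split.
  - destruct (lnum_surj n) as [l <-]; rewrite closed_lnum; intros Hl.
    assert (Hs : StronglySorted (fun a b : nat * nat => fst a < fst b)
      (map (fun a => (pi1 a, pi2 a)) l)).
    { induction l as [|a l IH]; [constructor|]; destruct Hl as [Ha Hl]; cbn; constructor; auto.
      apply Forall_forall; intros b Hb; apply in_map_iff in Hb as (b' & <- & Hb).
      now apply Ha. }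
    exists (Finfun Hs); rewrite num_finfun_lnum; cbn [fin_list]; rewrite map_map; f_equal.
    rewrite <- (map_id l) at 2; apply map_ext; intros a; apply pair_pi.
  - intros [[l Hl] <-]; rewrite num_finfun_lnum, closed_lnum; cbn [fin_list].
    induction Hl as [|a l Hl IH Ha]; [exact I|]; split; [|exact IH].
    intros b Hb; apply in_map_iff in Hb as (b' & <- & Hb).
    rewrite Forall_forall in Ha; specialize (Ha b' Hb).
    destruct a as [a1 a2], b' as [b1 b2].
    change (pi1 <<a1, a2>> < pi1 <<b1, b2>>); now rewrite !pi1_pair.
Qed.

Lemma dec_closed_code_ascending A f :
  Rec A f -> Dec A (fun x => closed_code ascending (f x)).
Proof.
  intros Hf; apply dec_ext with (fun x => forall i, i < f x -> drop (f x) i = 0 \/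
    forall b, b < tail (drop (f x) i) -> mem b (tail (drop (f x) i)) ->
      pi1 (head (drop (f x) i)) < pi1 b).
  - intros x; unfold closed_code, ascending.
    split; intros H i Hi; destruct (H i Hi); auto using mem_lt.
  - rec.
Qed.

(** The common properties through which partial functions and injective ones are treated at once.
    [arg_dec] is about a union, the form taken by compatibility of two finite functions; a single
    one is its union with itself. *)
Record argument_class (C : (nat -> nat -> Prop) -> Prop) : Prop := {
  arg_sub : forall r r', (forall a b, r a b -> r' a b) -> C r' -> C r;
  arg_function : forall r, C r -> is_function r;
  arg_succ : C (graph (fun x => Some (S x)));
  arg_dec : forall f g, Rec emptyset f -> Rec emptyset g ->
    Dec emptyset (fun x => C (fun a b => mem <<a, b>> (f x) \/ mem <<a, b>> (g x)))
}.

Lemma arg_fin_graph C (HC : argument_class C) (u : finfun) :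
  C (fun a b => mem <<a, b>> (num u) \/ mem <<a, b>> (num u)) <-> C (fin_graph u).
Proof.
  split; apply (arg_sub HC); intros a b; rewrite fin_graph_mem; tauto.
Qed.

Lemma arg_fin_graph_union C (HC : argument_class C) (u v : finfun) :
  C (fun a b => mem <<a, b>> (num u) \/ mem <<a, b>> (num v)) <->
  C (fun a b => fin_graph u a b \/ fin_graph v a b).
Proof.
  split; apply (arg_sub HC); intros a b; rewrite !fin_graph_mem; tauto.
Qed.

Lemma argument_class_function : argument_class is_function.
Proof.
  split; unfold is_function; eauto.
  - intros x y y' [= <-] [= <-]; reflexivity.
  - intros f g Hf Hg; apply dec_ext with (fun x =>
      forall s, s < f x + g x -> forall t, t < f x + g x ->
        (mem s (f x) \/ mem s (g x)) -> (mem t (f x) \/ mem t (g x)) ->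
        pi1 s = pi1 t -> pi2 s = pi2 t).
    + intros x; split.
      * intros H a b b' Hb Hb'; specialize (H <<a, b>>).
        rewrite <- (pi2_pair a b), <- (pi2_pair a b'); apply H; trivial;
          rewrite ?pi1_pair; trivial; destruct Hb as [Hb|Hb], Hb' as [Hb'|Hb'];
          apply mem_lt in Hb, Hb'; lia.
      * intros H s _ t _ Hs Ht E; apply (H (pi1 s)); [|rewrite E]; now rewrite pair_pi.
    + rec.
Qed.

Lemma argument_class_injective : argument_class is_injective_function.
Proof.
  destruct argument_class_function as [Hsub _ Hsucc Hdec]; split.
  - intros r r' H [H1 H2]; split; [eauto|]; intros x x' y Hx Hx'; eapply H2; eauto.
  - now intros r [H _].
  - split; [exact Hsucc|]; intros x x' y [= <-] [= <-]; reflexivity.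
  - intros f g Hf Hg; apply dec_and; [now apply Hdec|].
    apply dec_ext with (fun x =>
      forall s, s < f x + g x -> forall t, t < f x + g x ->
        (mem s (f x) \/ mem s (g x)) -> (mem t (f x) \/ mem t (g x)) ->
        pi2 s = pi2 t -> pi1 s = pi1 t).
    + intros x; split.
      * intros H a a' b Hb Hb'.
        rewrite <- (pi1_pair a b), <- (pi1_pair a' b); apply H; trivial;
          rewrite ?pi2_pair; trivial; destruct Hb as [Hb|Hb], Hb' as [Hb'|Hb'];
          apply mem_lt in Hb, Hb'; lia.
      * intros H s _ t _ Hs Ht E; apply (H (pi1 s) (pi1 t) (pi2 t)); [rewrite <- E|];
          now rewrite pair_pi.
    + rec.
Qed.

Lemma functional_of_relation C (HC : argument_class C) R :
  recursively_enumerable R -> functional C R ->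
  exists Phi, effectively_continuous C Phi /\ forall p f, C (graph f) -> forall x y,
    Phi p f x = Some y <->
    exists u, (forall a b, fin_graph u a b -> graph f a b) /\ R (u, p, x, y).
Proof.
  intros HR Hfun.
  destruct (partial_function (fun (t : word * pfun * nat) y =>
    exists u, (forall a b, fin_graph u a b -> graph (snd (fst t)) a b) /\
      R (u, fst (fst t), snd t, y))) as [F HF].
  assert (E : forall p f, C (graph f) -> forall x y, F (p, f, x) = Some y <->
    exists u, (forall a b, fin_graph u a b -> graph f a b) /\ R (u, p, x, y)).
  { intros p f Hf x; apply (HF (p, f, x)); cbn; intros y y' (u & Hu & HRu) (v & Hv & HRv).
    apply (proj2 Hfun u v p x y y' HRu HRv).
    revert Hf; apply (arg_sub HC); intros a b [H|H]; auto. }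
  exists (fun p f x => F (p, f, x)); split; [now exists R | exact E].
Qed.

(** By monotonicity, two values obtained from compatible finite functions are both values at their
    union, where [Q] is single-valued; by compactness, values at [f] are reached from its finite
    parts. *)
Lemma continuous_functional C (HC : argument_class C)
  (Q : word -> (nat -> nat -> Prop) -> nat -> nat -> Prop) :
  (forall p r r' x y, (forall a b, r a b -> r' a b) -> Q p r x y -> Q p r' x y) ->
  (forall p r x y y', C r -> Q p r x y -> Q p r x y' -> y = y') ->
  (forall p f x y, Q p (graph f) x y ->
     exists u, (forall a b, fin_graph u a b -> graph f a b) /\ Q p (fin_graph u) x y) ->
  (forall f g h k, Rec emptyset f -> Rec emptyset g -> Rec emptyset h -> Rec emptyset k ->
     Sig emptyset (fun z => Q (to_word (f z)) (fun a b => mem <<a, b>> (g z)) (h z) (k z))) ->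
  exists Phi, effectively_continuous C Phi /\ forall p f, C (graph f) -> forall x y,
    Phi p f x = Some y <-> Q p (graph f) x y.
Proof.
  intros Hmono Hdet Hcompact HQ.
  set (R := fun t : finfun * word * nat * nat => match t with (u, p, x, y) =>
    C (fin_graph u) /\ Q p (fin_graph u) x y end).
  destruct (@functional_of_relation C HC R) as (Phi & HPhi & E).
  - apply recursively_enumerable_sig.
    exists (fun z => C (fun a b => mem <<a, b>> (pi1 (pi1 (pi1 z))) \/
                                   mem <<a, b>> (pi1 (pi1 (pi1 z)))) /\
      Q (to_word (pi2 (pi1 (pi1 z)))) (fun a b => mem <<a, b>> (pi1 (pi1 (pi1 z))))
        (pi2 (pi1 z)) (pi2 z)); split.
    + apply sig_and; [apply sig_dec, (arg_dec HC) | apply HQ]; rec.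
    + intros [[[u p] x] y].
      change (num (u, p, x, y)) with <<<<<<num u, num p>>, x>>, y>>.
      repeat rewrite ?pi1_pair, ?pi2_pair; rewrite to_word_num; cbn [R].
      rewrite (arg_fin_graph HC).
      replace (fun a b => mem <<a, b>> (num u)) with (fin_graph u); [reflexivity|].
      extensionality a; extensionality b; apply propositional_extensionality, fin_graph_mem.
  - split; [now intros u p x y [H _]|].
    intros u v p x y y' [_ Hu] [_ Hv] Huv; apply (Hdet p _ x y y' Huv).
    + revert Hu; apply Hmono; auto.
    + revert Hv; apply Hmono; auto.
  - exists Phi; split; [exact HPhi|]; intros p f Hf x y; rewrite (E p f Hf); split.
    + intros (u & Hu & _ & HQu); revert HQu; now apply Hmono.
    + intros H; destruct (Hcompact p f x y H) as (u & Hu & HQu); exists u; split; [exact Hu|].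
      split; [|exact HQu]; revert Hf; now apply (arg_sub HC).
Qed.

(** * Iteration *)

(** Iteration of a relation instead of a function: it applies to coded finite graphs, its
    existential form is semidecidable, and exchanging [x] and [y] gives the iterates of the
    inverse. *)
Definition path (r : nat -> nat -> Prop) (n x y : nat) : Prop := exists L,
  seqn L 0 = x /\ seqn L n = y /\ forall i, i < n -> r (seqn L i) (seqn L (S i)).

Lemma path_0 r x y : path r 0 x y <-> x = y.
Proof.
  split; [now intros (L & <- & <- & _)|]; intros ->.
  exists <<y, 0>>; rewrite seqn_0; repeat split; lia.
Qed.

Lemma path_S r n x y : path r (S n) x y <-> exists z, r x z /\ path r n z y.
Proof.
  split.
  - intros (L & <- & <- & H); exists (seqn L 1); split; [apply H; lia|].
    exists (pi2 L); rewrite <- (pair_pi L) in *; setoid_rewrite seqn_S in H.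
    rewrite !seqn_S, pi2_pair; repeat split; intros i Hi.
    specialize (H (S i)); rewrite !seqn_S in H; apply H; lia.
  - intros (z & Hz & L & <- & <- & H); exists <<x, L>>; rewrite seqn_0, seqn_S.
    repeat split; intros [|i] Hi; rewrite ?seqn_0, ?seqn_S; [exact Hz | apply H; lia].
Qed.

Lemma iterate_path f n x y : iterate f n x = Some y <-> path (graph f) n x y.
Proof.
  revert x; induction n as [|n IH]; intros x; cbn [iterate].
  - rewrite path_0; split; congruence.
  - rewrite path_S; unfold graph at 1; split.
    + destruct (f x) as [z|]; [|discriminate]; intros H; exists z; now rewrite <- IH.
    + intros (z & -> & H); now apply IH.
Qed.

Lemma path_mono (r r' : nat -> nat -> Prop) n x y :
  (forall a b, r a b -> r' a b) -> path r n x y -> path r' n x y.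
Proof. intros H (L & H0 & Hn & HL); exists L; auto. Qed.

Lemma path_det r n x y y' : is_function r -> path r n x y -> path r n x y' -> y = y'.
Proof.
  intros Hr; revert x; induction n as [|n IH]; intros x; rewrite ?path_0, ?path_S; [congruence|].
  intros (z & Hz & H) (z' & Hz' & H'); rewrite (Hr _ _ _ Hz' Hz) in H'; eauto.
Qed.

Lemma path_det_inverse r n x x' y :
  is_injective_function r -> path r n x y -> path r n x' y -> x = x'.
Proof.
  intros [_ Hr]; revert x x'; induction n as [|n IH]; intros x x';
    rewrite ?path_0, ?path_S; [congruence|].
  intros (z & Hz & H) (z' & Hz' & H'); rewrite (IH _ _ H' H) in Hz'; eauto.
Qed.

Lemma finite_restriction f N :
  exists u : finfun, forall a b, fin_graph u a b <-> a < N /\ graph f a b.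
Proof.
  (* The window starts at an arbitrary [s], so that each induction step adds its smallest argument
     in front and the list stays increasing. *)
  assert (H : forall s, exists l, StronglySorted (fun a b : nat * nat => fst a < fst b) l /\
    forall a b, In (a, b) l <-> (s <= a < s + N) /\ graph f a b).
  { unfold graph; induction N as [|N IH]; intros s.
    - exists []; split; [constructor|]; cbn; intros; lia.
    - destruct (IH (S s)) as (l & Hl & Hin); destruct (f s) as [c|] eqn:E.
      + exists ((s, c) :: l); split.
        * constructor; [exact Hl|]; apply Forall_forall; intros [a b] H.
          apply Hin in H; cbn; lia.
        * intros a b; cbn [In]; rewrite Hin; split.
          -- intros [[= <- <-]|[H H']]; (split; [lia | assumption]).
          -- intros [H H']; destruct (Nat.eq_dec a s) as [->|]; [left; congruence|].
             right; split; [lia | exact H'].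
      + exists l; split; [exact Hl|]; intros a b; rewrite Hin; split.
        * intros [H H']; split; [lia | exact H'].
        * intros [H H']; split; [|exact H'].
          destruct (Nat.eq_dec a s) as [->|]; [congruence | lia]. }
  destruct (H 0) as (l & Hl & Hin); exists (Finfun Hl); intros a b.
  unfold fin_graph; cbn [fin_list]; rewrite Hin; split; intros [H1 H2]; (split; [lia | exact H2]).
Qed.

Lemma path_compact f n x y : path (graph f) n x y ->
  exists u, (forall a b, fin_graph u a b -> graph f a b) /\ path (fin_graph u) n x y.
Proof.
  intros (L & H0 & Hn & HL).
  assert (HN : exists N, forall i, i < n -> seqn L i < N).
  { clear; induction n as [|n [N HN]]; [exists 0; lia|].
    exists (S (N + seqn L n)); intros i Hi; destruct (Nat.eq_dec i n) as [->|]; [lia|].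
    assert (seqn L i < N) by (apply HN; lia); lia. }
  destruct HN as [N HN], (finite_restriction f N) as [u Hu]; exists u; split.
  - intros a b; rewrite Hu; tauto.
  - exists L; repeat split; trivial; intros i Hi; apply Hu; auto.
Qed.

Lemma sig_path A f g h k : Rec A f -> Rec A g -> Rec A h -> Rec A k ->
  Sig A (fun z => path (fun a b => mem <<a, b>> (f z)) (g z) (h z) (k z)).
Proof. intros Hf Hg Hh Hk; unfold path; rec. Qed.

Lemma continuous_iteration C (HC : argument_class C) F : PR emptyset F ->
  exists Phi, effectively_continuous C Phi /\ forall p n, F p = Some n ->
    forall f, C (graph f) -> forall x, Phi p f x = iterate f n x.
Proof.
  intros HF; apply partial_recursive_word in HF.
  destruct (continuous_functional HC
    (fun p r x y => exists n, F p = Some n /\ path r n x y)) as (Phi & HPhi & E).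
  - intros p r r' x y H (n & Hn & Hp); exists n; split; [exact Hn | revert Hp; now apply path_mono].
  - intros p r x y y' Hr (n & Hn & H) (n' & Hn' & H'); rewrite Hn in Hn'; injection Hn' as <-.
    apply (arg_function HC) in Hr; eapply path_det; eassumption.
  - intros p f x y (n & Hn & H); apply path_compact in H as (u & Hu & H); eauto.
  - intros f g h k Hf Hg Hh Hk; apply sig_ex, sig_and; cbv beta.
    + apply (sig_app2 (fun m y => F (to_word m) = Some y)); [exact HF | rec | rec].
    + apply sig_path; rec.
  - exists Phi; split; [exact HPhi|]; intros p n Hn f Hf x; apply option_ext; intros y.
    rewrite (E p f Hf), iterate_path; split; [|eauto].
    intros (n' & Hn' & H); congruence.
Qed.

Lemma continuous_inverse_iteration n :
  exists Phi, effectively_continuous is_injective_function Phi /\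
    forall (p : word) f, is_injective_function (graph f) -> forall x y,
      Phi p f x = Some y <-> iterate f n y = Some x.
Proof.
  destruct (continuous_functional argument_class_injective (fun p r x y => path r n y x))
    as (Phi & HPhi & E).
  - intros p r r' x y; apply path_mono.
  - intros p r x y y'; apply path_det_inverse.
  - intros p f x y; apply path_compact.
  - intros f g h k Hf Hg Hh Hk; apply sig_path; rec.
  - exists Phi; split; [exact HPhi|]; intros p f Hf x y; now rewrite iterate_path, E.
Qed.

(** * Church numerals *)

Section Church.

Variables (C : (nat -> nat -> Prop) -> Prop) (D : Type).
Variable numeral : (pfun -> pfun) -> D -> Prop.

Definition church_family : family D := fun G =>
  exists Phi, effectively_continuous C Phi /\ defined_by G (fun p => numeral (Phi p)).

Hypothesis HC : argument_class C.
Hypothesis numeral_ext : forall Psi Psi' v,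
  (forall f, C (graph f) -> forall x, Psi f x = Psi' f x) -> numeral Psi v -> numeral Psi' v.
Hypothesis numeral_unique : forall Psi v v', numeral Psi v -> numeral Psi v' -> v = v'.
Hypothesis numeral_onto : forall v,
  exists Phi, effectively_continuous C Phi /\ forall p, numeral (Phi p) v.

(** Universality cannot simply come from listing all r.e. relations, since some are not functional.
    They are trimmed uniformly, and the functional ones must survive unchanged so that every member
    of the family is reached. *)
Lemma self_enumerated_church : self_enumerated church_family.
Proof.
  split; [|split].
  - intros G phi (Phi & (R & HR & [Hdom Hfun] & E) & HG) Hphi; exists (fun p => Phi (phi p)).
    split; [|intros p v; apply HG].
    exists (fun t => match t with (u, p, x, y) => R (u, phi p, x, y) end); split; [|split].
    + apply recursively_enumerable_sig in HR as (N & HN & HR).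
      apply recursively_enumerable_sig.
      exists (fun z => N <<<<<<pi1 (pi1 (pi1 z)), num (phi (to_word (pi2 (pi1 (pi1 z)))))>>,
                              pi2 (pi1 z)>>, pi2 z>>); split.
      * apply total_recursive_word in Hphi; apply (sig_app HN).
        repeat apply rec_pair; [| apply (rec_app Hphi) | |]; rec.
      * intros [[[u p] x] y]; rewrite HR.
        change (num (u, p, x, y)) with <<<<<<num u, num p>>, x>>, y>>.
        repeat rewrite ?pi1_pair, ?pi2_pair; now rewrite to_word_num.
    + split; [intros u p x y; apply Hdom | intros u v p x y y'; apply Hfun].
    + intros p f Hf x y; apply (E (phi p) f Hf).
  - assert (Hhalt : Sig emptyset (fun z => exists y, universal emptyset (pi1 z) (pi2 z) y))
      by (apply sig_ex, sig_universal; rec).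
    destruct Hhalt as (E & HE & Hhalt).
    assert (Hhalt' : forall n z, (exists y, universal emptyset n z y) <->
      exists s, E <<<<n, z>>, s>>).
    { intros n z; specialize (Hhalt <<n, z>>); now rewrite pi1_pair, pi2_pair in Hhalt. }
    clear Hhalt.
    (* The [i]-th r.e. relation is made functional by keeping a tuple only if it
       agrees with the compatible tuples that have a smaller code [<<v, <<y, s>>>>],
       where [s] is a stage of enumeration. *)
    set (kept := fun i m x n y =>
      C (fun a b => mem <<a, b>> n \/ mem <<a, b>> n) /\
      exists s, E <<<<i, <<<<<<n, m>>, x>>, y>>>>, s>> /\
        forall t, t < <<n, <<y, s>>>> -> closed_code ascending (pi1 t) ->
          E <<<<i, <<<<<<pi1 t, m>>, x>>, pi1 (pi2 t)>>>>, pi2 (pi2 t)>> ->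
          C (fun a b => mem <<a, b>> n \/ mem <<a, b>> (pi1 t)) -> pi1 (pi2 t) = y).
    set (R := fun t : finfun * word * nat * nat => match t with (u, w, x, y) =>
      kept (tag_index w) (num (tag_word w)) x (num u) y end).
    assert (HR : recursively_enumerable R).
    { apply recursively_enumerable_sig.
      exists (fun z => kept (tag_index (to_word (pi2 (pi1 (pi1 z)))))
        (num (tag_word (to_word (pi2 (pi1 (pi1 z)))))) (pi2 (pi1 z)) (pi1 (pi1 (pi1 z))) (pi2 z)).
      split.
      - assert (HI : forall f, Rec emptyset f -> Rec emptyset (fun x => tag_index (to_word (f x))))
          by (intros f; apply rec_tag_index).
        assert (HWord : forall f, Rec emptyset f ->
          Rec emptyset (fun x => num (tag_word (to_word (f x)))))
          by (intros f; apply rec_tag_word).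
        unfold kept; apply sig_and; [apply sig_dec, (arg_dec HC); rec|].
        apply sig_ex, sig_dec; cbv beta.
        repeat first [apply HI | apply HWord | apply dec_closed_code_ascending
                     | apply (arg_dec HC) | progress rec].
      - intros [[[u p] x] y]; unfold R.
        change (num (u, p, x, y)) with <<<<<<num u, num p>>, x>>, y>>.
        repeat rewrite ?pi1_pair, ?pi2_pair; now rewrite to_word_num. }
    assert (Hfun : functional C R).
    { split; [intros u p x y [H _]; now apply (arg_fin_graph HC)|].
      intros u v p x y y' (_ & s & Hs & Hmin) (_ & s' & Hs' & Hmin') Huv.
      assert (Hu : closed_code ascending (num u)) by (apply closed_code_finfun; now exists u).
      assert (Hv : closed_code ascending (num v)) by (apply closed_code_finfun; now exists v).
      (* Of two compatible tuples, the one with the larger code has been tested against the other;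
         equal codes already contain equal values. *)
      destruct (Nat.lt_trichotomy <<num u, <<y, s>>>> <<num v, <<y', s'>>>>) as [H|[H|H]].
      - specialize (Hmin' _ H); repeat rewrite ?pi1_pair, ?pi2_pair in Hmin'.
        apply Hmin'; trivial; apply (arg_fin_graph_union HC).
        revert Huv; apply (arg_sub HC); tauto.
      - now apply pair_inj in H as [_ H]; apply pair_inj in H.
      - specialize (Hmin _ H); repeat rewrite ?pi1_pair, ?pi2_pair in Hmin.
        symmetry; apply Hmin; trivial; now apply (arg_fin_graph_union HC). }
    destruct (functional_of_relation HC HR Hfun) as (Phi & HPhi & HPhiR).
    destruct (partial_function (fun p => numeral (Phi p))) as [U HU].
    assert (HU' : defined_by U (fun p => numeral (Phi p))) by (intros p; apply HU; eauto).
    exists U; split; [now exists Phi|].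
    intros G (Psi & (T & [c Hc] & [Tdom Tfun] & HPsi) & HG); exists (code_num c).
    assert (HRT : forall u p x y, R (u, tag (code_num c) p, x, y) <-> T (u, p, x, y)).
    { assert (HT : forall u p x y, T (u, p, x, y) <->
        exists s, E <<<<code_num c, <<<<<<num u, num p>>, x>>, y>>>>, s>>).
      { intros u p x y; rewrite <- Hhalt', Hc.
        change (num (u, p, x, y)) with <<<<<<num u, num p>>, x>>, y>>.
        split; intros [z Hz]; exists z; now apply universal_code. }
      intros u p x y; unfold R; rewrite tag_index_tag, tag_word_tag; split.
      - intros (_ & s & Hs & _); apply HT; eauto.
      (* As [T] is functional, all compatible tuples carry the same value, and the test in [kept]
         discards nothing. *)
      - intros H; split; [now apply (arg_fin_graph HC), (Tdom u p x y)|].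
        destruct (proj1 (HT u p x y) H) as [s Hs]; exists s; split; [exact Hs|].
        intros t _ Ht Hst HCt; apply closed_code_finfun in Ht as [v Hv].
        rewrite <- Hv in *; apply (arg_fin_graph_union HC) in HCt.
        symmetry; apply (Tfun u v p x y _ H); [apply HT; eauto | exact HCt]. }
    intros p; apply option_ext; intros v; rewrite (HG p v), (HU' _ v).
    assert (Heq : forall f, C (graph f) -> forall x, Psi p f x = Phi (tag (code_num c) p) f x).
    { intros f Hf x; apply option_ext; intros y; rewrite (HPsi p f Hf), (HPhiR _ f Hf).
      split; intros (u & Hu & H); exists u; (split; [exact Hu | now apply HRT]). }
    split; apply numeral_ext; intros f Hf x; [|symmetry]; now apply Heq.
  - intros v; destruct (numeral_onto v) as (Phi & HPhi & Hv).
    exists (fun _ => Some v), []; split; [|reflexivity]; exists Phi; split; [exact HPhi|].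
    intros p w; split; [now intros [= <-] | intros Hw; f_equal; eauto].
Qed.

Variable of_nat : nat -> D.

Hypothesis numeral_iterate : forall Psi n,
  (forall f, C (graph f) -> forall x, Psi f x = iterate f n x) -> numeral Psi (of_nat n).
Hypothesis numeral_succ : forall Psi n,
  numeral Psi (of_nat n) -> Psi (fun x => Some (S x)) 0 = Some n.

Lemma church_of_PR F : PR emptyset F ->
  exists G, church_family G /\ forall p n, F p = Some n -> G p = Some (of_nat n).
Proof.
  intros HF; destruct (continuous_iteration HC HF) as (Phi & HPhi & E).
  destruct (partial_function (fun p => numeral (Phi p))) as [G HG].
  assert (HG' : defined_by G (fun p => numeral (Phi p))) by (intros p; apply HG; eauto).
  exists G; split; [now exists Phi|]; intros p n Hn; now apply HG', numeral_iterate, E.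
Qed.

Lemma PR_of_church G : church_family G ->
  exists F, PR emptyset F /\ forall p n, G p = Some (of_nat n) -> F p = Some n.
Proof.
  intros (Phi & (R & HR & _ & E) & HG).
  apply recursively_enumerable_sig in HR as (N & HN & HR).
  (* The number [n] ranges over codes of finite parts of the successor function; the bound [a < n]
     follows from membership and keeps the test decidable. *)
  destruct (@PR_uniformize emptyset (fun p y => exists n, closed_code ascending n /\
    (forall a, a < n -> mem a n -> pi2 a = S (pi1 a)) /\ N <<<<<<n, num p>>, 0>>, y>>))
    as (F & HF & Hspec).
  { apply sig_ext with (fun z => exists n, closed_code ascending n /\
      (forall a, a < n -> mem a n -> pi2 a = S (pi1 a)) /\ N <<<<<<n, pi1 z>>, 0>>, pi2 z>>).
    - intros z; now rewrite num_to_word.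
    - apply sig_ex, sig_and; [apply sig_dec, dec_closed_code_ascending; rec|].
      apply sig_and; [apply sig_dec|]; rec. }
  exists F; split; [exact HF|]; intros p n Hn; apply HG, numeral_succ in Hn.
  assert (HPhi : forall y, Phi p (fun x => Some (S x)) 0 = Some y <->
    exists n, closed_code ascending n /\
    (forall a, a < n -> mem a n -> pi2 a = S (pi1 a)) /\ N <<<<<<n, num p>>, 0>>, y>>).
  { intros y; rewrite (E p _ (arg_succ HC)); split.
    - intros (u & Hu & Hy); exists (num u); split; [apply closed_code_finfun; now exists u|].
      split; [|now apply HR in Hy].
      intros a _ Ha; rewrite <- (pair_pi a) in Ha; apply fin_graph_mem, Hu in Ha.
      now injection Ha.
    - intros (k & Hk & Hsucc & Hy); apply closed_code_finfun in Hk as [u <-].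
      exists u; split; [|now apply HR].
      intros a b Hab; apply fin_graph_mem in Hab; pose proof (Hsucc _ (mem_lt Hab) Hab) as H.
      rewrite pi1_pair, pi2_pair in H; now rewrite H. }
  destruct (Hspec p) as [H1 H2]; destruct H2 as [y Hy]; [exists n; now apply HPhi|].
  assert (Hy' : Some n = Some y) by (rewrite <- Hn; now apply HPhi, H1); congruence.
Qed.

Lemma church_complexity : (fun n => complexity church_family (of_nat n)) =ct K.
Proof.
  pose proof self_enumerated_church as H; pose proof (self_enumerated_PR emptyset) as HP; split.
  - apply (complexity_le of_nat (fun n => n) (d := 0) H HP); intros U HU.
    destruct (church_of_PR HU) as (G & HG & E); exists G; split; [exact HG | auto].
  - apply (complexity_le (fun n => n) of_nat (d := 0) HP H); intros U HU.
    destruct (PR_of_church HU) as (G & HG & E); exists G; split; [exact HG | auto].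
Qed.

End Church.

(** * Natural and integer Church numerals as instances *)

Lemma iterate_succ n x : iterate (fun x => Some (S x)) n x = Some (n + x).
Proof.
  revert x; induction n as [|n IH]; intros x; cbn; [reflexivity|].
  rewrite IH; f_equal; lia.
Qed.

Lemma iterate_last f n x :
  iterate f (S n) x = match iterate f n x with Some y => f y | None => None end.
Proof.
  revert x; induction n as [|n IH]; intros x; [cbn; now destruct (f x)|].
  cbn [iterate] in *; destruct (f x) as [y|]; [apply IH | reflexivity].
Qed.

(** Inversion reverses the order of the steps: the first step of one iteration is the last step of
    the other, hence [iterate_last]. *)
Lemma iterate_inverse f g : inverse_of f g ->
  forall n x y, iterate g n y = Some x <-> iterate f n x = Some y.
Proof.
  intros H; induction n as [|n IH]; intros x y; [cbn; split; congruence|].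
  rewrite iterate_last; cbn [iterate]; split.
  - destruct (iterate g n y) as [z|] eqn:E; [|discriminate]; intros Hz.
    apply H in Hz as ->; now apply IH.
  - destruct (f x) as [z|] eqn:E; [|discriminate]; intros Hz.
    apply IH in Hz as ->; now apply H.
Qed.

Lemma is_function_graph f : is_function (graph f).
Proof. unfold is_function, graph; intros x y y'; congruence. Qed.

Lemma church_nat_ext Psi Psi' n :
  (forall f, is_function (graph f) -> forall x, Psi f x = Psi' f x) ->
  church_nat Psi n -> church_nat Psi' n.
Proof.
  intros E H f x; rewrite <- E; [apply H | apply is_function_graph].
Qed.

Lemma church_nat_succ Psi n : church_nat Psi n -> Psi (fun x => Some (S x)) 0 = Some n.
Proof. intros H; rewrite H, iterate_succ; f_equal; lia. Qed.

Lemma church_nat_unique Psi n n' : church_nat Psi n -> church_nat Psi n' -> n = n'.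
Proof. intros H H'; apply church_nat_succ in H, H'; congruence. Qed.

Lemma church_nat_onto n : exists Phi,
  effectively_continuous is_function Phi /\ forall p, church_nat (Phi p) n.
Proof.
  destruct (@continuous_iteration _ argument_class_function (fun _ => Some n))
    as (Phi & HPhi & E).
  - apply partial_recursive_word, sig_ext with (fun z => pi2 z = n); [|rec].
    intros z; split; [now intros -> | now intros [= ->]].
  - exists Phi; split; [exact HPhi|]; intros p f x; apply (E p n eq_refl), is_function_graph.
Qed.

Lemma church_nat_iterate Psi n :
  (forall f, is_function (graph f) -> forall x, Psi f x = iterate f n x) -> church_nat Psi n.
Proof. intros H f x; apply H, is_function_graph. Qed.

Lemma injective_succ : is_injective_function (graph (fun x => Some (S x))).
Proof. exact (arg_succ argument_class_injective). Qed.

Lemma church_int_ext Psi Psi' z :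
  (forall f, is_injective_function (graph f) -> forall x, Psi f x = Psi' f x) ->
  church_int Psi z -> church_int Psi' z.
Proof.
  intros E H f Hf; destruct (H f Hf) as [H1 H2]; split.
  - intros Hz x; rewrite <- E; auto.
  - intros Hz; destruct (H2 Hz) as (g & Hg & Hx); exists g; split; [exact Hg|].
    intros x; rewrite <- E; auto.
Qed.

(** On the successor function, which is injective, the numeral of [z] is translation by [z],
    undefined where the result would be negative. *)
Lemma church_int_succ Psi z : church_int Psi z -> forall x y,
  Psi (fun x => Some (S x)) x = Some y <-> (Z.of_nat y = Z.of_nat x + z)%Z.
Proof.
  intros H x y; destruct (H _ injective_succ) as [H1 H2].
  destruct (Z_le_gt_dec 0 z) as [Hz|Hz].
  - rewrite H1, iterate_succ by exact Hz; split; [intros [= <-]; lia|].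
    intros E; f_equal; lia.
  - destruct H2 as (g & Hg & Hx); [lia|]; rewrite Hx, (iterate_inverse Hg), iterate_succ.
    split; [intros [= <-]; lia | intros E; f_equal; lia].
Qed.

Lemma church_int_unique Psi z z' : church_int Psi z -> church_int Psi z' -> z = z'.
Proof.
  (* The point [x] is large enough for translation by [z] to stay in [nat], including when [z] is
     negative. *)
  intros H H'; set (x := Z.to_nat (- z)); set (y := Z.to_nat (Z.of_nat x + z)).
  assert (E : Psi (fun x => Some (S x)) x = Some y) by (apply (church_int_succ H); lia).
  apply (church_int_succ H') in E; lia.
Qed.

Lemma church_int_iterate Psi n :
  (forall f, is_injective_function (graph f) -> forall x, Psi f x = iterate f n x) ->
  church_int Psi (Z.of_nat n).
Proof.
  intros H f Hf; split; [|lia]; intros _ x; rewrite Nat2Z.id; now apply H.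
Qed.

Lemma church_int_onto z : exists Phi,
  effectively_continuous is_injective_function Phi /\ forall p, church_int (Phi p) z.
Proof.
  destruct (Z_le_gt_dec 0 z) as [Hz|Hz].
  - destruct (@continuous_iteration _ argument_class_injective (fun _ => Some (Z.to_nat z)))
      as (Phi & HPhi & E).
    + apply partial_recursive_word, sig_ext with (fun t => pi2 t = Z.to_nat z); [|rec].
      intros t; split; [now intros -> | now intros [= ->]].
    + exists Phi; split; [exact HPhi|]; intros p.
      rewrite <- (Z2Nat.id z) by exact Hz; apply church_int_iterate, E; reflexivity.
  - destruct (continuous_inverse_iteration (Z.to_nat (- z))) as (Phi & HPhi & E).
    exists Phi; split; [exact HPhi|]; intros p f Hf; split; [lia|]; intros _.
    destruct (partial_function (fun y x => f x = Some y)) as [g Hg].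
    assert (Hg' : inverse_of f g).
    { intros x y; apply (Hg y); intros v v'; apply Hf. }
    exists g; split; [exact Hg'|]; intros x; apply option_ext; intros y.
    now rewrite (E p f Hf), (iterate_inverse Hg').
Qed.

Lemma KN_church_K : KN_church =ct K.
Proof.
  exact (@church_complexity _ _ church_nat argument_class_function church_nat_ext
    church_nat_unique church_nat_onto (fun n => n) church_nat_iterate church_nat_succ).
Qed.

Lemma KZ_church_K : restrict_nat KZ_church =ct K.
Proof.
  refine (@church_complexity _ _ church_int argument_class_injective church_int_ext
    church_int_unique church_int_onto Z.of_nat church_int_iterate _).
  intros Psi n H; apply (church_int_succ H); lia.
Qed.

Lemma KZ_Delta_church_K : restrict_nat KZ_Delta_church =ct K.
Proof.
  pose proof (@self_enumerated_church _ _ church_nat argument_class_function church_nat_ext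
    church_nat_unique church_nat_onto) as H.
  pose proof (self_enumerated_PR emptyset) as HP.
  apply self_enumerated_Delta in H as HD.
  assert (Hiter : forall F, PR emptyset F ->
    exists G, ChurchN G /\ forall p n, F p = Some n -> G p = Some n).
  { intros F HF; exact (@church_of_PR _ _ church_nat argument_class_function
      church_nat_unique (fun n => n) church_nat_iterate _ HF). }
  split.
  - apply (complexity_le Z.of_nat (fun n => n) (d := 0) HD HP); intros U HU.
    destruct (Hiter U HU) as (G & HG & E).
    (* A natural number is obtained as its own numeral minus the constant numeral 0. *)
    destruct (Hiter (fun _ => Some 0)) as (G0 & HG0 & E0).
    { apply partial_recursive_word, sig_ext with (fun z => pi2 z = 0); [|rec].
      intros z; split; [now intros -> | now intros [= ->]]. }
    exists (fun p => match G p, G0 p with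
                     | Some a, Some b => Some (Z.of_nat a - Z.of_nat b)%Z
                     | _, _ => None
                     end); split; [exists G, G0; now split|].
    intros p n _ Hn; rewrite (E p n Hn), (E0 p 0 eq_refl); f_equal; lia.
  - apply (complexity_le (fun n => n) Z.of_nat (d := 0) HP HD); intros U HU.
    destruct (@Delta_extension emptyset ChurchN) with (G := U) as (G & HG & E); [|exact HU|].
    + intros G HG.
      exact (@PR_of_church _ _ church_nat argument_class_function (fun n => n) church_nat_succ _ HG).
    + exists G; split; [exact HG | auto].
Qed.

Theorem theorem1p4
  (WN : word -> nat -> Prop) (WN2 : word -> nat * nat -> Prop)
  (hWN : acceptable WN) (hWN2 : acceptable WN2) :
  (KN_church =ct restrict_nat KZ_church /\
   restrict_nat KZ_church =ct restrict_nat KZ_Delta_church /\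
   restrict_nat KZ_Delta_church =ct K) /\
  (KN_card WN =ct Kmax /\
   restrict_nat (KZ_Delta_card WN) =ct K_oracle (jump emptyset)) /\
  (KN_index WN2 =ct Kmax_oracle (jump emptyset) /\
   restrict_nat (KZ_Delta_index WN2) =ct K_oracle (jump (jump emptyset))).
Proof.
  pose proof (counting_Card hWN) as Hcard; pose proof (counting_Index hWN2) as Hindex.
  split; [|split; split].
  - split; [|split].
    + exact (ct_eq_trans KN_church_K (ct_eq_sym KZ_church_K)).
    + exact (ct_eq_trans KZ_church_K (ct_eq_sym KZ_Delta_church_K)).
    + exact KZ_Delta_church_K.
  - exact (counting_MaxPR Hcard).
  - exact (counting_Delta Hcard).
  - exact (counting_MaxPR Hindex).
  - exact (counting_Delta Hindex).
Qed.
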